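(* For every positive integer $r$ and every one of the six models (Independent set, MAX-CUT, anti-ferromagnetic Ising, $q$-Coloring, K-SAT, NAE-K-SAT), there exists a (model dependent) $H(r)$ such that $$\lim_{N\to\infty,\ N\in r^{-1}K\mathbb{Z}_+}N^{-1}H\big(\mathbb{G}(N,r)\big)=H(r)$$ with high probability (in probability).
   Context: Let $K\ge2$, $\chi=\{0,\dots,q-1\}$, $[N]=\{1,\dots,N\}$, and assume $Nr/K$ is an integer. The random $r$-regular hypergraph $\mathbb{G}(N,r)$ is built by the configuration model: each node $i\in[N]$ is given $r$ copies (points), giving $Nr$ points; a uniformly random partition of these $Nr$ points into $Nr/K$ blocks of size $K$ is chosen, and each block is projected to the (directed) hyperedge formed by the nodes owning its $K$ points. For a hypergraph $G=([N],E)$ with node potentials $H_i$ and edge potentials $H_e:\chi^K\to\mathbb{R}\cup\{-\infty\}$, $H(x)=\sum_iH_i(x_i)+\sum_{e\in E}H_e(x_e)$ and $H(G)=\max_{x\in\chi^N}H(x)$. Models: Independent set ($K=2,q=2$, $H_i(1)=1,H_i(0)=0$, $H_e(1,1)=-\infty$, else $0$); MAX-CUT ($K=2,q=2$, $H_i\equiv0$, $H_e(x,y)=\mathbf 1[x\ne y]$); anti-ferromagnetic Ising ($K=2,q=2$, fixed $\beta>0,B\in\mathbb{R}$, $H_i(0)=-B,H_i(1)=B$, $H_e(x,y)=-\beta$ if $x=y$, $\beta$ otherwise); $q$-Coloring ($K=2$, $H_i\equiv0$, $H_e(x,y)=\mathbf 1[x\ne y]$); K-SAT ($q=2$, $H_i\equiv0$,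 independent uniform $a_e\in\{0,1\}^K$ per hyperedge, $H_e(a_e)=0$, $1$ otherwise); NAE-K-SAT (same with $H_e(a_e)=H_e(\mathbf1-a_e)=0$, $1$ otherwise). *)

(* Defs.v *)
From HB Require Import structures.
From mathcomp Require Import all_boot all_order all_algebra.
From mathcomp Require Import reals constructive_ereal.
Set Implicit Arguments. Unset Strict Implicit. Unset Printing Implicit Defensive.
Import Order.TTheory GRing.Theory Num.Theory.
Local Open Scope ring_scope.
Local Open Scope ereal_scope.

(* A (random) hypergraph model: hyperedge size K, alphabet chi = 'I_q,
   node potential, and an edge potential depending on a random label
   (uniform on the finite type L, independently for each hyperedge).
   Deterministic models use L = unit. The edge potential is applied to the
   sequence (x_{e_1}, ..., x_{e_K}) of the K spins along a directed
   hyperedge; only sequences of length K ever occur. *)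
Record model (R : realType) := Model {
  mK : nat;
  mq : nat;
  mL : finType;
  hnode : 'I_mq -> \bar R;
  hedge : mL -> seq 'I_mq -> \bar R }.

Section Models.
Variable R : realType.

Definition ind (b : bool) : \bar R := if b then 1 else 0.

Definition IS_model : model R :=
  @Model R 2 2 unit (fun i => ind (val i == 1%N))
    (fun _ s => if [seq val i | i <- s] == [:: 1%N; 1%N] then -oo else 0).

Definition MAXCUT_model : model R :=
  @Model R 2 2 unit (fun _ => 0)
    (fun _ s => if s is [:: x; y] then ind (x != y) else 0).

Definition Ising_model (beta B : R) : model R :=
  @Model R 2 2 unit (fun i => if val i == 1%N then B%:E else (- B)%:E)
    (fun _ s => if s is [:: x; y] then
                  (if x == y then (- beta)%:E else beta%:E) else 0).

Definition Coloring_model (q : nat) : model R :=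
  @Model R 2 q unit (fun _ => 0)
    (fun _ s => if s is [:: x; y] then ind (x != y) else 0).

Definition KSAT_model (K : nat) : model R :=
  @Model R K 2 (K.-tuple bool) (fun _ => 0)
    (fun a s => ind ([seq val i | i <- s] != [seq nat_of_bool b | b <- a])).

Definition NAEKSAT_model (K : nat) : model R :=
  @Model R K 2 (K.-tuple bool) (fun _ => 0)
    (fun a s => ind (([seq val i | i <- s] != [seq nat_of_bool b | b <- a]) &&
                     ([seq val i | i <- s] != [seq nat_of_bool (~~ b) | b <- a]))).
End Models.

Section Config.
Variables (R : realType) (M : model R) (N r : nat).

(* Points: node i has the r copies (i, 0), ..., (i, r-1). *)
Definition point := ('I_N * 'I_r)%type.

Definition config_ok (P : {set {set point}}) : bool :=
  partition P [set: point] && [forall B in P, #|B| == mK M].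

(* Sample space: a configuration together with labels for all possible blocks
   (only labels of blocks of the partition matter); the uniform measure on
   this space is the configuration model with i.i.d. uniform edge labels. *)
Definition sample := ({set {set point}} * {ffun {set point} -> mL M})%type.

Definition Omega : {set sample} := [set w : sample | config_ok w.1].

(* The directed hyperedge of a block: owners of its points, listed in the
   (canonical) enumeration order of the points. *)
Definition hyperedge (B : {set point}) : seq 'I_N := [seq p.1 | p <- enum B].

Definition Hx (w : sample) (x : {ffun 'I_N -> 'I_(mq M)}) : \bar R :=
  (\sum_(i < N) @hnode R M (x i)) +
  (\sum_(B in w.1) @hedge R M (w.2 B) [seq x i | i <- hyperedge B]).

Definition HG (w : sample) : \bar R :=
  \big[maxe/-oo]_(x : {ffun 'I_N -> 'I_(mq M)}) Hx w x.

Definition prob_dev (h eps : R) : R :=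
  (#|[set w in Omega | (`| HG w * (N%:R^-1)%:E - h%:E | > eps%:E)%E]|%:R
     / #|Omega|%:R)%R.
End Config.

Definition conv_in_prob (R : realType) (M : model R) (r : nat) (h : R) : Prop :=
  forall eps delta : R, (0 < eps)%R -> (0 < delta)%R ->
  exists N0 : nat, forall N : nat, (N0 <= N)%N -> (mK M %| N * r)%N ->
    (prob_dev M N r h eps <= delta)%R.

(* Main.v *)
(* Interpolation by slots. Split the node set in two, and fix any partition of
   the points into blocks of size K. If the points of each part are permuted
   uniformly at random, the expected maximum only depends on how many points of
   the first part each block contains. Replacing one mixed block by a block
   inside a single part, chosen with probability proportional to the number of
   points the mixed block has in it, cannot raise the expectation by more than
   O(1/number of free points): the loss caused by an edge is a positive
   combination of products of indicators, and
   prod_k x_k <= (1/K) sum_k x_k^K. The imbalance created by these random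
   choices is a martingale, controlled by its second moment. Hence
   a(m + n) >= a(m) + a(n) - O((m + n)^(3/4)) for the expected maximum a and
   comparable m and n, so that a(n)/n converges; transposing two points changes
   the maximum by O(1), so its variance is O(n) and Chebyshev concludes. *)

Require Import Defs.
From HB Require Import structures.
From mathcomp Require Import all_boot all_order all_algebra all_fingroup.
From mathcomp Require Import reals constructive_ereal.
From mathcomp Require Import ring lra zify.
Set Implicit Arguments. Unset Strict Implicit. Unset Printing Implicit Defensive.
Import Order.TTheory GRing.Theory Num.Theory.
Local Open Scope ring_scope.

(** * Averages over finite sets and variance over permutations *)

(** Regularity is the obstacle: every point lies in exactly one block, so an edge can only be added
    on points that are still free, and both parts must keep free points throughout. A reserve of
    order [m0] free points on each side is bought by discarding that many edges, and the points left
    at the end are filled by arbitrary edges inside a part. A balanced walk of at most N bounded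
    steps moves the reserve by about N^(1/2), so [m0] must lie between N^(1/2) and N. The two main
    errors are [m0] and N^2 / m0^2; N^(2/3) would balance them, but any exponent below 1 suffices,
    and N^(3/4) is convenient because a fourth root is an iterated square root. No random walk is
    constructed: an induction on the number of mixed blocks carries a quadratic error term. Two
    features of the models must be fitted to this scheme. Blocks list their points in a canonical
    order that permutations do not respect, so the law of a labelled edge has to be invariant under
    reordering. The infinite penalty of Independent set breaks the Lipschitz bounds and is exchanged
    for a finite one. *)

Section Averages.
Variable R : realType.

Definition avg (I : finType) (A : {set I}) (f : I -> R) : R :=
  (\sum_(i in A) f i) / #|A|%:R.

Definition var (I : finType) (A : {set I}) (f : I -> R) : R :=
  avg A (fun i => f i ^+ 2) - avg A f ^+ 2.

Section OneSet.
Variables (I : finType) (A : {set I}).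
Implicit Types f g : I -> R.

Lemma eq_avg f g : {in A, f =1 g} -> avg A f = avg A g.
Proof. by move=> fg; rewrite /avg (eq_bigr _ fg). Qed.

Lemma avg_le f g : {in A, forall i, f i <= g i} -> avg A f <= avg A g.
Proof. by move=> fg; rewrite ler_wpM2r ?invr_ge0 ?ler0n // ler_sum. Qed.

Lemma avg_const (c : R) : (0 < #|A|)%N -> avg A (fun=> c) = c.
Proof.
move=> A0; rewrite /avg sumr_const -[c *+ _]mulr_natr mulfK //.
by rewrite pnatr_eq0 -lt0n.
Qed.

Lemma avgD f g : avg A (fun i => f i + g i) = avg A f + avg A g.
Proof. by rewrite /avg big_split mulrDl. Qed.

Lemma avgZ (c : R) f : avg A (fun i => c * f i) = c * avg A f.
Proof. by rewrite /avg -mulr_sumr mulrA. Qed.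

Lemma avgN f : avg A (fun i => - f i) = - avg A f.
Proof. by rewrite /avg sumrN mulNr. Qed.

Lemma avgB f g : avg A (fun i => f i - g i) = avg A f - avg A g.
Proof. by rewrite avgD avgN. Qed.

Lemma avg_ge f (c : R) :
  (0 < #|A|)%N -> {in A, forall i, c <= f i} -> c <= avg A f.
Proof. by move=> A0 cf; rewrite -(avg_const c A0); apply: avg_le. Qed.

Lemma avg_le_const f (c : R) :
  (0 < #|A|)%N -> {in A, forall i, f i <= c} -> avg A f <= c.
Proof. by move=> A0 cf; rewrite -(avg_const c A0); apply: avg_le. Qed.

Lemma avg_dist f g (c : R) : (0 < #|A|)%N ->
  {in A, forall i, `|f i - g i| <= c} -> `|avg A f - avg A g| <= c.
Proof.
move=> A0 fg; rewrite -avgB ler_norml; apply/andP; split.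
  by apply: avg_ge => // i iA; have := fg i iA; rewrite ler_norml => /andP[].
by apply: avg_le_const => // i iA; have := fg i iA; rewrite ler_norml => /andP[].
Qed.

Lemma avg_reindex (h : I -> I) f : injective h ->
  (forall i, (h i \in A) = (i \in A)) -> avg A (fun i => f (h i)) = avg A f.
Proof.
move=> hI hA; rewrite /avg; congr (_ / _).
rewrite [RHS](reindex_inj hI) /=.
by apply: eq_bigl => i; rewrite hA.
Qed.

Lemma var_le f (c : R) : (0 < #|A|)%N ->
  var A f <= avg A (fun i => (f i - c) ^+ 2).
Proof.
move=> A0.
have -> : avg A (fun i => (f i - c) ^+ 2) = var A f + (avg A f - c) ^+ 2.
  have -> : avg A (fun i => (f i - c) ^+ 2)
    = avg A (fun i => f i ^+ 2 + ((- (2 * c)) * f i + c ^+ 2)).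
    by apply: eq_avg => i _; ring.
  by rewrite avgD avgD avgZ avg_const // /var; ring.
by rewrite lerDl sqr_ge0.
Qed.

Lemma var_bound f (c b : R) : (0 < #|A|)%N ->
  {in A, forall i, `|f i - c| <= b} -> var A f <= b ^+ 2.
Proof.
move=> A0 fb; apply: le_trans (var_le f c A0) _.
apply: avg_le_const => // i iA; rewrite -real_normK ?num_real //.
by rewrite lerXn2r ?nnegrE ?fb // (le_trans _ (fb i iA)).
Qed.

End OneSet.

Lemma avg_exchange (I J : finType) (A : {set I}) (B : {set J}) (f : I -> J -> R) :
  avg A (fun i => avg B (f i)) = avg B (fun j => avg A (f^~ j)).
Proof.
rewrite /avg -!mulr_suml exchange_big /= -!mulrA; congr (_ * _).
exact: mulrC.
Qed.

(** Each [act j] permutes [A] and so preserves the uniform average; averaging over [j] inserts an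
    extra independent randomisation. This is how random permutations of the points enter the
    configuration model. *)
Lemma avg_double (I J : finType) (A : {set I}) (B : {set J})
    (act : J -> I -> I) (f : I -> R) : (0 < #|B|)%N ->
  {in B, forall j, injective (act j)} ->
  {in B, forall j i, (act j i \in A) = (i \in A)} ->
  avg A f = avg A (fun i => avg B (fun j => f (act j i))).
Proof.
move=> B0 actI actA; rewrite avg_exchange.
rewrite [RHS](eq_avg (g := fun=> avg A f)) ?avg_const // => j jB.
by apply: avg_reindex => [|i]; [exact: actI | exact: actA].
Qed.

End Averages.

(** * The cone of edge functions that admit the interpolation *)

Section PositiveCone.
Variables (R : realType) (K : nat) (T : finType).
Hypothesis K0 : (0 < K)%N.
Implicit Types l : {ffun 'I_K -> T} -> R.

(** Unnormalised expectation of [l] when the entries of the edge are independent, the entry [k]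
    having weights [mu k]. *)
Definition wsum (mu : 'I_K -> T -> R) l : R :=
  \sum_(e : {ffun 'I_K -> T}) (\prod_k mu k (e k)) * l e.

(* Sampling the K entries of an edge from K different distributions charges
   [l] at most as much as sampling them all from one of the K distributions
   chosen uniformly. *)
Definition kpos l := forall mu : 'I_K -> T -> R, (forall k t, 0 <= mu k t) ->
  wsum mu l <= K%:R^-1 * \sum_j wsum (fun=> mu j) l.

Lemma wsumD mu l1 l2 : wsum mu (fun e => l1 e + l2 e) = wsum mu l1 + wsum mu l2.
Proof. by rewrite /wsum -big_split; apply: eq_bigr => e _; rewrite mulrDr. Qed.

Lemma wsumZ mu c l : wsum mu (fun e => c * l e) = c * wsum mu l.
Proof. by rewrite /wsum mulr_sumr; apply: eq_bigr => e _; rewrite mulrCA. Qed.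

Lemma eq_kpos l1 l2 : l1 =1 l2 -> kpos l1 -> kpos l2.
Proof.
move=> ll pl mu mu0; have E nu : wsum nu l2 = wsum nu l1.
  by apply: eq_bigr => e _; rewrite ll.
by rewrite E (eq_bigr _ (fun j _ => E _)); apply: pl.
Qed.

Lemma kposD l1 l2 : kpos l1 -> kpos l2 -> kpos (fun e => l1 e + l2 e).
Proof.
move=> p1 p2 mu mu0; rewrite wsumD (eq_bigr _ (fun j _ => wsumD _ _ _)).
by rewrite big_split mulrDr lerD ?p1 ?p2.
Qed.

Lemma kposZ c l : 0 <= c -> kpos l -> kpos (fun e => c * l e).
Proof.
move=> c0 pl mu mu0; rewrite wsumZ (eq_bigr _ (fun j _ => wsumZ _ _ _)).
by rewrite -mulr_sumr mulrCA ler_wpM2l ?pl.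
Qed.

Lemma kpos0 : kpos (fun=> 0).
Proof.
move=> mu _; have E nu : wsum nu (fun=> 0) = 0.
  by rewrite /wsum big1 // => e _; rewrite mulr0.
by rewrite E big1 ?mulr0 // => j _; rewrite E.
Qed.

Lemma kpos_sum (I : finType) (f : I -> {ffun 'I_K -> T} -> R) :
  (forall i, kpos (f i)) -> kpos (fun e => \sum_i f i e).
Proof.
move=> pf; elim: (index_enum I) => [|i s IH].
  by apply: eq_kpos kpos0 => e; rewrite big_nil.
by apply: eq_kpos (kposD (pf i) IH) => e; rewrite big_cons.
Qed.

(** Inequality of arithmetic and geometric means for the numbers [x k ^+ K], whose geometric mean is
    the product of the [x k]. *)
Lemma prod_le_mean_pow (x : 'I_K -> R) : (forall k, 0 <= x k) ->
  \prod_k x k <= K%:R^-1 * \sum_k x k ^+ K.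
Proof.
move=> x0.
have s0 : 0 <= K%:R^-1 * \sum_k x k ^+ K.
  by rewrite mulr_ge0 ?invr_ge0 ?ler0n // sumr_ge0 // => k _; rewrite exprn_ge0.
rewrite -(ler_pXn2r K0) ?nnegrE ?prodr_ge0 // -prodrXl.
have [+ _] := @leif_AGM R 'I_K predT (fun k => x k ^+ K) (fun k _ => exprn_ge0 K (x0 k)).
by rewrite cardE /= -cardE card_ord mulrC.
Qed.

Lemma wsum_prod mu (f : T -> R) :
  wsum mu (fun e => \prod_k f (e k)) = \prod_k \sum_t mu k t * f t.
Proof.
rewrite bigA_distr_bigA /=; apply: eq_bigr => e _.
by rewrite -big_split.
Qed.

(** By independence both sides are expressed through the K numbers [\sum_t mu k t * f t], to which
    [prod_le_mean_pow] applies. *)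
Lemma kpos_prod (f : T -> R) : (forall t, 0 <= f t) -> kpos (fun e => \prod_k f (e k)).
Proof.
move=> f0 mu mu0; rewrite wsum_prod.
under [X in _ <= _ * X]eq_bigr => j _ do rewrite wsum_prod prodr_const card_ord.
by apply: prod_le_mean_pow => k; apply: sumr_ge0 => t _; rewrite mulr_ge0.
Qed.

End PositiveCone.

(** * Variance of a Lipschitz function of a random permutation *)

Section PermVariance.
Variables (R : realType) (T : finType) (f : {perm T} -> R) (c : R).
Hypothesis f_lip : forall x y s, `|f (tperm x y * s)%g - f s| <= c.

(** A permutation supported on [B] that sends [x] to [y] is uniquely a permutation fixing [x]
    followed by [tperm x y]; the image of [x] is uniform on [B]. *)
Lemma perm_on_split (B : {set T}) (x : T) (F : {perm T} -> R) : x \in B ->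
  avg [set s | perm_on B s] F =
  avg B (fun y => avg [set s | perm_on (B :\ x) s] (fun s => F (s * tperm x y)%g)).
Proof.
move=> xB.
have on2 s y : perm_on (B :\ x) s -> y \in B -> perm_on B (s * tperm x y)%g.
  move=> sB yB; apply: perm_onM.
    by apply: subset_trans sB (subD1set _ _).
  apply/subsetP => z; rewrite inE /=; case: tpermP => [->|->|] //.
  by rewrite eqxx.
have fixx s : perm_on (B :\ x) s -> s x = x.
  by move=> sB; apply: (out_perm sB); rewrite !inE eqxx.
have sums : \sum_(s in [set s | perm_on B s]) F s =
    \sum_(y in B) \sum_(s in [set s | perm_on (B :\ x) s]) F (s * tperm x y)%g.
  rewrite (partition_big (fun s : {perm T} => s x) (mem B)) /=; last first.
    by move=> s; rewrite inE => sB; rewrite (perm_closed _ sB).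
  apply: eq_bigr => y yB.
  rewrite (reindex_inj (mulIg (tperm x y))) /=.
  apply: eq_bigl => s; rewrite !inE; apply/andP/idP => [[sB /eqP sx]|sB]; last first.
    by rewrite on2 // permM (fixx _ sB) tpermL eqxx.
  have sx' : s x = x.
    by move: sx; rewrite permM => sx; rewrite -[s x](tpermK x y) sx tpermR.
  apply/subsetP => z; rewrite !inE => szN.
  have zx : z != x by apply: contraNneq szN => ->; rewrite sx'.
  rewrite zx /=; apply: contraT => zB; case/negP: szN; apply/eqP.
  move: (out_perm sB zB); rewrite permM => sz; rewrite -[s z](tpermK x y) sz tpermD //.
    by rewrite eq_sym.
  by apply: contraNneq zB => <-.
have cards : #|[set s : {perm T} | perm_on B s]| =
    (#|B| * #|[set s : {perm T} | perm_on (B :\ x) s]|)%N.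
  by rewrite !cardsE !card_perm (cardsD1 x B) xB factS.
rewrite /avg sums cards natrM invfM mulrA [_ / #|B|%:R]mulrC -mulrA mulr_suml.
by rewrite [RHS]mulrC.
Qed.

Lemma perm_on_card_gt0 (B : {set T}) : (0 < #|[set s : {perm T} | perm_on B s]|)%N.
Proof. by apply/card_gt0P; exists 1%g; rewrite inE perm_on1. Qed.

(** Law of total variance, conditioning on the image [y] of one point [x]. The conditional variances
    fall under the induction hypothesis, which is why it allows an arbitrary factor [rho]; the
    conditional means are all close to the one for [y = x]. *)
Lemma var_perm_on (B : {set T}) (rho : {perm T}) :
  var [set s | perm_on B s] (fun s => f (s * rho)%g) <= #|B|%:R * (2 * c) ^+ 2.
Proof.
have [n Bn] := ubnP #|B|; elim: n B rho Bn => // n IH B rho Bn.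
have [->|[x xB]] := set_0Vmem B.
  rewrite cards0 mul0r.
  have -> : [set s : {perm T} | perm_on set0 s] = [set 1%g].
    apply/setP => s; rewrite !inE; apply/idP/eqP => [s0|->]; last exact: perm_on1.
    by apply/permP => z; rewrite perm1 (out_perm s0) ?inE.
  by rewrite /var /avg !big_set1 cards1 !divr1 subrr.
have B0 : (0 < #|B|)%N by apply/card_gt0P; exists x.
set A' := [set s | perm_on (B :\ x) s].
have A'0 : (0 < #|A'|)%N := perm_on_card_gt0 _.
pose g y := avg A' (fun s => f (s * tperm x y * rho)%g).
have -> : var [set s | perm_on B s] (fun s => f (s * rho)%g) =
    avg B (fun y => var A' (fun s => f (s * tperm x y * rho)%g)) + var B g.
  rewrite /var !(perm_on_split _ xB) -/A' avgB; rewrite /g; ring.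
have cB : #|B| = (#|B :\ x|).+1 by rewrite (cardsD1 x B) xB.
rewrite cB -natr1 mulrDl mul1r lerD //.
  apply: avg_le_const => // y yB.
  have -> : var A' (fun s => f (s * tperm x y * rho)%g) =
            var A' (fun s => f (s * (tperm x y * rho))%g).
    by rewrite /var; congr (_ - _ ^+ 2); apply: eq_avg => s _; rewrite mulgA.
  by apply: IH; rewrite -cB in Bn *; lia.
pose g0 := avg A' (fun s => f (s * rho)%g).
apply: (var_bound (c := g0)) => // y yB; apply: avg_dist => // s sA.
(* Conjugation by [s] moves the transposition to the left, where [f_lip] applies. *)
have -> : (s * tperm x y * rho = tperm (s^-1 x) (s^-1 y) * (s * rho))%g.
  by rewrite -tpermJ conjgE invgK !mulgA mulgVK.
apply: le_trans (f_lip _ _ _) _.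
(* Any instance of [f_lip] shows [0 <= c], hence [c <= 2 * c]. *)
by have := f_lip x x 1%g; have := normr_ge0 (f (tperm x x * 1)%g - f 1%g); lra.
Qed.

Lemma var_perm : var [set: {perm T}] f <= #|T|%:R * (2 * c) ^+ 2.
Proof.
have -> : var [set: {perm T}] f = var [set s | perm_on setT s] (fun s => f (s * 1)%g).
  have -> : [set: {perm T}] = [set s | perm_on setT s].
    by apply/setP => s; rewrite !inE; apply/esym/subsetP => z _; rewrite inE.
  by rewrite /var; congr (_ - _ ^+ 2); apply: eq_avg => s _; rewrite mulg1.
by rewrite -cardsT; exact: var_perm_on.
Qed.

End PermVariance.

(** * Energies and the loss caused by a random edge *)

(* Edge potentials of the form pbase - ppen * [the labelled edge is bad].
   ppos is the only convexity property of the model that is used: for every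
   nonempty set of configurations, the probability over the label that all of
   them make an edge bad is, as a function of the edge, in the cone kpos. *)
Record penalty_model (R : realType) := PenaltyModel {
  pK : nat;
  pq : nat;
  pL : finType;
  pspin : 'I_pq;
  plab : pL;
  pnode : 'I_pq -> R;
  pbase : R;
  ppen : R;
  pbad : pL -> seq 'I_pq -> bool;
  pK_gt0 : (0 < pK)%N;
  ppen_ge0 : 0 <= ppen;
  psym : forall s : {perm 'I_pK}, exists2 phi : pL -> pL, injective phi &
    forall a (y : 'I_pK -> 'I_pq),
      pbad (phi a) [seq y (s k) | k <- enum 'I_pK] =
      pbad a [seq y k | k <- enum 'I_pK];
  ppos : forall (T : finType) (X : eqType) (F : X -> T -> 'I_pq) (y : X) (Y : seq X),
    kpos (fun e : {ffun 'I_pK -> T} => \sum_a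
      (all (fun z => pbad a [seq F z (e k) | k <- enum 'I_pK]) (y :: Y))%:R : R)
}.

Section FirstViolation.
Variables (R : realType) (X : eqType) (w : R) (v : X -> R) (b : X -> bool).
Hypothesis vw : forall x, v x <= w.

(** For [s] sorted by increasing loss [v], this is the least loss among the configurations that
    satisfy the edge, with the value [w] when all of [s] violate it. *)
Fixpoint first_ok (s : seq X) : R :=
  if s is x :: s' then if b x then first_ok s' else v x else w.

Lemma first_ok_le s : first_ok s <= w.
Proof. by elim: s => //= x s IH; case: ifP. Qed.

Lemma first_ok_min s x : pairwise (fun x y => v x <= v y) s ->
  x \in s -> ~~ b x -> first_ok s <= v x.
Proof.
elim: s => //= z s IH /andP[/allP zs ps]; rewrite inE => /predU1P[->|xs] bx.
  by rewrite (negbTE bx).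
by case: ifP => _; [exact: IH | exact: zs].
Qed.

Lemma first_ok_attained s :
  first_ok s = w \/ exists2 x, ~~ b x & first_ok s = v x.
Proof.
elim: s => [|x s IH] /=; first by left.
by case: ifPn => // bx; right; exists x.
Qed.

End FirstViolation.

Section Energies.
Variables (R : realType) (M : penalty_model R).
Local Notation K := (pK M).
Local Notation q := (pq M).
Local Notation L := (pL M).

Lemma label_gt0 : (0 < #|[set: L]|)%N.
Proof. by apply/card_gt0P; exists (plab M). Qed.

Definition spins V (x : V -> 'I_q) (e : {ffun 'I_K -> V}) : seq 'I_q :=
  [seq x (e k) | k <- enum 'I_K].

Section Nodes.
Variable V : finType.
Local Notation config := {ffun V -> 'I_q}.

(* A hypergraph enters only through its total energy, a function of the spins. *)
Local Notation energy := {ffun config -> R}.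
Implicit Types (U W F : energy) (e : {ffun 'I_K -> V}).
Definition edge (a : L) (e : {ffun 'I_K -> V}) : energy :=
  [ffun x : config => pbase M - ppen M * (pbad a (spins x e))%:R].

Definition hmax (U : energy) : R :=
  U [arg max_(x > [ffun=> pspin M] : config) U x]%O.

Lemma hmax_ge U x : U x <= hmax U.
Proof. by rewrite /hmax; case: arg_maxP => // y _ /(_ x); apply. Qed.

Lemma hmax_attained U : exists x, hmax U = U x.
Proof. by eexists. Qed.

Lemma hmax_le U (c : R) : (forall x, U x <= c) -> hmax U <= c.
Proof. by move=> Uc; have [x ->] := hmax_attained U. Qed.

Lemma hmax_lip U F (c : R) : (forall x, `|F x| <= c) -> `|hmax (U + F) - hmax U| <= c.
Proof.
move=> Fc; rewrite ler_distl; apply/andP; split.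
  have [x ->] := hmax_attained U; rewrite lerBlDr.
  have := hmax_ge (U + F) x; rewrite ffunE.
  by have := Fc x; rewrite ler_norml => /andP[]; lra.
apply: hmax_le => x; rewrite ffunE; have := hmax_ge U x.
by have := Fc x; rewrite ler_norml => /andP[]; lra.
Qed.

(* Mean of g at the energy U plus that of the edges Q, over their random labels. *)
Fixpoint EL (g : energy -> R) (Q : seq {ffun 'I_K -> V}) (U : energy) : R :=
  if Q is e :: Q' then avg [set: L] (fun a => EL g Q' (U + edge a e)) else g U.

Lemma EL_swap g (e1 e2 : {ffun 'I_K -> V}) Q U : EL g [:: e1, e2 & Q] U = EL g [:: e2, e1 & Q] U.
Proof.
rewrite /= avg_exchange; apply: eq_avg => a _; apply: eq_avg => b _.
by rewrite addrAC.
Qed.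

Lemma EL_cat_cons g e Q1 Q2 U : EL g (Q1 ++ e :: Q2) U = EL g (e :: Q1 ++ Q2) U.
Proof.
elim: Q1 U => // e1 Q1 IH U.
rewrite [RHS]EL_swap /=; apply: eq_avg => a _; rewrite IH //.
Qed.

Lemma EL_perm g Q1 Q2 U : perm_eq Q1 Q2 -> EL g Q1 U = EL g Q2 U.
Proof.
elim: Q1 Q2 U => [|e Q1 IH] Q2 U.
  by rewrite perm_sym => /perm_nilP ->.
move=> QQ; have /path.splitPr E : e \in Q2 by rewrite -(perm_mem QQ) inE eqxx.
case: E QQ => s1 s2 QQ; rewrite EL_cat_cons /=; apply: eq_avg => a _; apply: IH.
by move: QQ; rewrite perm_sym -cat1s perm_catCA cat1s perm_cons perm_sym.
Qed.

(** A bound on the energy of one edge, hence on the change of the maximum when an edge is added. *)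
Definition lip : R := `|pbase M| + ppen M.

Lemma lip_ge0 : 0 <= lip.
Proof. by rewrite addr_ge0 ?ppen_ge0. Qed.

Lemma edge_le a e x : `|edge a e x| <= lip.
Proof.
rewrite ffunE; apply: le_trans (ler_normB _ _) _; rewrite lerD2l.
by rewrite ger0_norm ?mulr_ge0 ?ppen_ge0 //; case: pbad; rewrite ?mulr1 ?mulr0 ?ppen_ge0.
Qed.

Lemma EL_dist g1 g2 Q U (c : R) : (forall W, `|g1 W - g2 W| <= c) ->
  `|EL g1 Q U - EL g2 Q U| <= c.
Proof.
move=> gg; elim: Q U => //= e Q IH U.
by apply: avg_dist label_gt0 _ => a _.
Qed.

(** Moves the average over the label of [e] innermost, so that the effect of adding [e] is studied
    at a fixed energy of the other edges. *)
Lemma EL_rcons g Q e U : EL g (e :: Q) U =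
  EL (fun W => avg [set: L] (fun a => g (W + edge a e))) Q U.
Proof.
have -> : EL g (e :: Q) U = EL g (rcons Q e) U.
  by apply: EL_perm; rewrite perm_sym perm_rcons.
elim: Q U => //= e1 Q IH U; exact: eq_avg.
Qed.

Lemma EL_cons_dist e Q U : `|EL hmax (e :: Q) U - EL hmax Q U| <= lip.
Proof.
rewrite EL_rcons; apply: EL_dist => W.
rewrite -[X in _ - X](avg_const _ label_gt0).
apply: avg_dist label_gt0 _ => a _; apply: hmax_lip => x; exact: edge_le.
Qed.

Lemma EL_cat_dist Q1 Q2 U :
  `|EL hmax (Q1 ++ Q2) U - EL hmax Q2 U| <= (size Q1)%:R * lip.
Proof.
elim: Q1 => [|e Q1 IH]; first by rewrite subrr normr0 mul0r.
rewrite cat_cons [size _]/= -natr1 mulrDl mul1r.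
apply: le_trans (ler_distD (EL hmax (Q1 ++ Q2) U) _ _) _.
by rewrite addrC lerD // EL_cons_dist.
Qed.

(** By [psym], reordering the nodes of an edge amounts to a bijection of its labels, which the
    uniform average over labels does not see. *)
Lemma EL_codom g (e1 e2 : {ffun 'I_K -> V}) Q U : perm_eq (codom e1) (codom e2) ->
  EL g (e1 :: Q) U = EL g (e2 :: Q) U.
Proof.
move=> ee; have [s es] : exists s : {perm 'I_K}, forall k, e1 k = e2 (s k).
  have sz1 : size (codom e1) == K by rewrite size_codom card_ord.
  have sz2 : size (codom e2) == K by rewrite size_codom card_ord.
  have /tuple_permP[s E] : perm_eq (codom e1) (Tuple sz2) by [].
  exists s => k; have := congr1 (fun t => nth (e1 k) t k) E.
  rewrite (nth_map k) ?size_enum_ord // nth_ord_enum => ->.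
  rewrite (nth_map k) ?size_enum_ord // nth_ord_enum (tnth_nth (e1 k)) /=.
  by rewrite (nth_map k) ?size_enum_ord // nth_ord_enum.
have [phi phiI phiE] := psym s; rewrite /=.
rewrite -(avg_reindex (A := [set: L]) (h := phi)) //; last by move=> a; rewrite !inE.
apply: eq_avg => a _; congr (EL _ _ (_ + _)).
apply/ffunP => x; rewrite !ffunE; congr (_ - _ * (nat_of_bool _)%:R).
by rewrite /spins -(phiE a (x \o e2)); congr pbad; apply: eq_map => k /=; rewrite es.
Qed.

Lemma EL_map_codom g (I : eqType) (s : seq I) (f1 f2 : I -> {ffun 'I_K -> V}) U :
  {in s, forall i, perm_eq (codom (f1 i)) (codom (f2 i))} ->
  EL g (map f1 s) U = EL g (map f2 s) U.
Proof.
elim: s U => // i s IH U ff; rewrite !map_cons.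
rewrite (EL_codom _ _ _ (ff i (mem_head _ _))) /=.
apply: eq_avg => a _; apply: IH => j js; apply: ff; exact: mem_behead.
Qed.

(** Law of total variance, revealing one label at a time: given the first label the induction
    applies, and the conditional means stay within [lip] of the mean without that edge. *)
Lemma EL_var Q U :
  EL (fun W => hmax W ^+ 2) Q U - EL hmax Q U ^+ 2 <= (size Q)%:R * lip ^+ 2.
Proof.
elim: Q U => [|e Q IH] U; first by rewrite /= subrr mul0r.
have -> : EL (fun W => hmax W ^+ 2) (e :: Q) U - EL hmax (e :: Q) U ^+ 2 =
    avg [set: L] (fun a => EL (fun W => hmax W ^+ 2) Q (U + edge a e)
                           - EL hmax Q (U + edge a e) ^+ 2) +
    var [set: L] (fun a => EL hmax Q (U + edge a e)).
  by rewrite /var avgB /=; ring.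
rewrite -[size _]/(size Q).+1 -natr1 mulrDl mul1r lerD //.
  by apply: avg_le_const label_gt0 _ => a _; exact: IH.
apply: (var_bound (c := EL hmax Q U)) label_gt0 _ => a _.
have shift W F : EL hmax Q (W + F) = EL (fun W' => hmax (W' + F)) Q W.
  by elim: Q {IH} W => //= e1 Q IH W; apply: eq_avg => b _; rewrite addrAC IH.
rewrite shift; apply: EL_dist => W; apply: hmax_lip => x; exact: edge_le.
Qed.

Section Loss.
Variables (U : energy) (T : finType) (p : T -> V).

(** The loss when the optimum moves to [x], capped by the cost of keeping the old optimum and paying
    the penalty. *)
Local Notation gap x := (Num.min (ppen M) (hmax U - U x)).
Local Notation bads a e := (fun x : config => pbad a (spins (x \o p) e)).
Local Notation fst_ok a e := (first_ok (ppen M) (fun x => gap x) (bads a e)).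

Let gap_le x : gap x <= ppen M.
Proof. by rewrite ge_min lexx. Qed.

(** Summation by parts: on [x :: s] the quantity [first_ok - lo] equals [gap x - lo] plus, when [x]
    is bad, [first_ok s - gap x]. The increments are nonnegative because [s] is sorted, and each one
    multiplies the indicator that all configurations met so far are bad, which [ppos] handles. *)
Lemma kpos_first_ok (s : seq config) y (Y : seq config) lo :
  pairwise (fun x z => gap x <= gap z) s -> lo <= ppen M -> all (fun x => lo <= gap x) s ->
  kpos (fun e : {ffun 'I_K -> T} => \sum_a (all (fun z : config => pbad a (spins (z \o p) e)) (y :: Y))%:R *
                        (fst_ok a e s - lo)).
Proof.
pose pos_fam (x : config) := x \o p.
elim: s y Y lo => [|x s IH] y Y lo.
  move=> _ low _; have w0 : 0 <= ppen M - lo by rewrite subr_ge0.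
  apply: eq_kpos (kposZ w0 (ppos pos_fam y Y)) => e.
  by rewrite mulr_sumr; apply: eq_bigr => a _; rewrite mulrC.
move=> /andP[xs ps] low /andP[lox los].
have g0 : 0 <= gap x - lo by rewrite subr_ge0.
have := kposD (kposZ g0 (ppos pos_fam y Y)) (IH x (y :: Y) (gap x) ps (gap_le x) xs).
apply: eq_kpos => e; rewrite mulr_sumr -big_split; apply: eq_bigr => a _.
set B := all _ (y :: Y).
rewrite -[all _ (x :: y :: Y)]/(pbad a (spins (x \o p) e) && B) [first_ok _ _ _ (x :: s)]/=.
case: (pbad a (spins (x \o p) e)) => /=; last by rewrite mul0r addr0 mulrC.
by rewrite /spins; ring.
Qed.

Definition by_gap : seq config := sort (relpre (fun x => gap x) <=%R) (enum config).

(** The new optimum is either a satisfying configuration of least gap or the old optimum with the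
    penalty paid; capping the gaps merges the two cases. The list stays sorted with [xm] in front
    because its gap is 0. *)
Lemma hmax_edge a (e : {ffun 'I_K -> T}) xm : hmax U = U xm ->
  hmax (U + edge a [ffun k => p (e k)]) =
  hmax U + pbase M - fst_ok a e (xm :: by_gap).
Proof.
move=> hm; set v := fst_ok a e _.
have tr : transitive (relpre (fun x => gap x) <=%R : rel config).
  by move=> x y z /=; exact: le_trans.
have ps : pairwise (fun x z => gap x <= gap z) (xm :: by_gap).
  rewrite /= -sorted_pairwise ?sort_sorted //; last by move=> x y; exact: le_total.
  rewrite andbT; apply/allP => x _.
  have -> : gap xm = 0 by rewrite hm subrr; apply/min_idPr; exact: ppen_ge0.
  by rewrite le_min ppen_ge0 subr_ge0 hmax_ge.
have sp (x : config) : spins x [ffun k => p (e k)] = spins (x \o p) e.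
  by apply: eq_map => k; rewrite ffunE.
apply/eqP; rewrite eq_le; apply/andP; split.
  apply: hmax_le => x; rewrite 2!ffunE sp.
  have := hmax_ge U x.
  case: (boolP (pbad _ _)) => B; rewrite ?mulr1 ?mulr0.
    by have : v <= ppen M := first_ok_le _ gap_le _; lra.
  have : v <= gap x.
    by apply: first_ok_min ps _ B; rewrite inE mem_sort mem_enum orbT.
  by rewrite le_min => /andP[]; lra.
have via (x : config) : ~~ pbad a (spins (x \o p) e) -> hmax U - U x <= v ->
    hmax U + pbase M - v <= hmax (U + edge a [ffun k => p (e k)]).
  move=> B xv; apply: le_trans (hmax_ge _ x); rewrite 2!ffunE sp (negbTE B) mulr0; lra.
have viam : ppen M <= v -> hmax U + pbase M - v <= hmax (U + edge a [ffun k => p (e k)]).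
  move=> wv; apply: le_trans (hmax_ge _ xm); rewrite 2!ffunE sp -hm.
  have := ppen_ge0 M; case: pbad; rewrite ?mulr1 ?mulr0; lra.
have [E|[x B vx]] := first_ok_attained (ppen M) (fun x => gap x) (bads a e) (xm :: by_gap).
  by apply: viam; rewrite /v E.
rewrite -/v in vx; have [g|g] := leP (ppen M) (hmax U - U x).
  by apply: viam; rewrite vx le_min lexx.
by apply: (via x) => //; rewrite vx le_min lexx ltW.
Qed.

(* Layer-cake: the expected loss caused by a new edge is a nonnegative
   combination, over nested sets S of near-optimal configurations, of the
   probabilities that all elements of S violate the edge. *)
Lemma kpos_loss : kpos (fun e : {ffun 'I_K -> T} =>
  hmax U + pbase M - EL hmax [:: [ffun k => p (e k)]] U).
Proof.
have [xm hm] := hmax_attained U.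
have L0 : 0 <= #|[set: L]|%:R^-1 :> R by rewrite invr_ge0.
have lo x : 0 <= gap x by rewrite le_min ppen_ge0 subr_ge0 hmax_ge.
have sortp : pairwise (fun x z => gap x <= gap z) by_gap.
  rewrite -sorted_pairwise ?sort_sorted //; first by move=> x y; exact: le_total.
  by move=> x y z /=; exact: le_trans.
have all0 : all (fun x => 0 <= gap x) by_gap by apply/allP => x _.
(* The optimum [xm] supplies the initial nonempty family: it has gap 0, so the loss vanishes unless
   the edge is bad at [xm]. *)
have := kposZ L0 (kpos_first_ok xm [::] sortp (ppen_ge0 M) all0).
apply: eq_kpos => e.
rewrite /= (eq_avg (g := fun a => (hmax U + pbase M) - fst_ok a e (xm :: by_gap))); last first.
  by move=> a _; rewrite (hmax_edge _ _ hm).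
rewrite avgB avg_const ?label_gt0 // subKr /avg mulrC; congr (_ * _).
apply: eq_big => [a|a _]; first by rewrite inE.
rewrite /= andbT subr0; case: pbad => /=; rewrite ?mul1r ?mul0r //.
by rewrite hm subrr; apply/esym/min_idPr; rewrite ppen_ge0.
Qed.

End Loss.
End Nodes.
End Energies.

(** * Interpolation between global and local edges *)

Lemma card_bigcup_le (I J : finType) (P : pred I) (F : I -> {set J}) :
  (#|\bigcup_(i | P i) F i| <= \sum_(i | P i) #|F i|)%N.
Proof.
elim/big_rec2: _ => [|i m A _ IH]; first by rewrite cards0.
by apply: leq_trans (leq_card_setU _ _) _; rewrite leq_add2l.
Qed.

(** [Q] is a partial partition of the points into blocks when its slots are distinct, and a full one
    when they enumerate [T]. *)
Definition slots (R : realType) (M : penalty_model R) (T : finType)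
    (Q : seq {ffun 'I_(pK M) -> T}) : seq T :=
  flatten [seq codom e | e : {ffun 'I_(pK M) -> T} <- Q].

Lemma slots_map (R : realType) (M : penalty_model R) (T1 T : finType) (f : T1 -> T)
    (Q : seq {ffun 'I_(pK M) -> T1}) :
  slots [seq [ffun k => f (e k)] | e : {ffun 'I_(pK M) -> T1} <- Q] = map f (slots Q).
Proof.
elim: Q => //= e Q IH; rewrite /slots /= map_cat; congr (_ ++ _); last exact: IH.
by rewrite /codom /image_mem -map_comp; apply: eq_map => k /=; rewrite ffunE.
Qed.

Section Interpolation.
Variables (R : realType) (M : penalty_model R) (V T : finType) (own : T -> V).
Variables (U0 : {ffun {ffun V -> 'I_(pq M)} -> R}) (c : T -> bool).
Local Notation K := (pK M).
Local Notation tup := {ffun 'I_K -> T}.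
Implicit Types (e : tup) (Q : seq tup) (s : {perm T}) (b : bool).

Definition act s e : tup := [ffun k => s (e k)].
Definition img s Q : seq {ffun 'I_K -> V} := [seq [ffun k => own (s (e k))] | e : tup <- Q].
(** The colour [c] tells in which of the two parts a point lies; a constant [c] allows all
    permutations. *)
Definition colperm : {set {perm T}} := [set s : {perm T} | [forall t : T, c (s t) == c t]].
Definition Val Q : R := avg colperm (fun s => EL (@hmax R M V) (img s Q) U0).

Lemma colpermP s : reflect (forall t, c (s t) = c t) (s \in colperm).
Proof. by rewrite inE; apply: (iffP forallP) => h t; apply/eqP. Qed.

Lemma colperm_gt0 : (0 < #|colperm|)%N.
Proof. by apply/card_gt0P; exists 1%g; apply/colpermP => t; rewrite perm1. Qed.

Lemma size_codomK (A : finType) (e : {ffun 'I_K -> A}) : size (codom e) = K.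
Proof. by rewrite size_codom card_ord. Qed.

Lemma codom_inj (A : finType) : injective (fun e : {ffun 'I_K -> A} => codom e).
Proof.
by move=> e1 e2 ee; apply: (can_inj fgraphK); rewrite !fgraph_codom; apply: val_inj.
Qed.

Lemma size_slots Q : size (slots Q) = (size Q * K)%N.
Proof. by elim: Q => //= e Q IH; rewrite size_cat IH size_codomK mulSn. Qed.

Lemma slots_inj Q1 Q2 : slots Q1 = slots Q2 -> Q1 = Q2.
Proof.
elim: Q1 Q2 => [|e1 Q1 IH] [|e2 Q2] // E.
- by have := congr1 size E; rewrite !size_slots; have := pK_gt0 M; rewrite /=; lia.
- by have := congr1 size E; rewrite !size_slots; have := pK_gt0 M; rewrite /=; lia.
move/eqP: E; rewrite /slots /= eqseq_cat ?size_codomK // => /andP[/eqP/codom_inj -> /eqP].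
by move/IH => ->.
Qed.

Lemma slots_act s Q : slots (map (act s) Q) = map s (slots Q).
Proof. exact: slots_map. Qed.

Lemma perm_slots Q1 Q2 : perm_eq Q1 Q2 -> perm_eq (slots Q1) (slots Q2).
Proof. by move=> QQ; apply/perm_flatten/perm_map. Qed.

Lemma colperm_extend (s1 s2 : seq T) : uniq s1 -> uniq s2 -> map c s1 = map c s2 ->
  exists2 p, p \in colperm & map p s1 = s2.
Proof.
elim: s1 s2 => [|x s1 IH] [|y s2] //.
  by exists 1%g => //; apply/colpermP => t; rewrite perm1.
move=> /= /andP[xs u1] /andP[ys u2] [cxy cs].
have [p /colpermP pc ps] := IH s2 u1 u2 cs.
exists (p * tperm (p x) y)%g.
  apply/colpermP => t; rewrite permM; case: tpermP => [e|e|_ _]; last exact: pc.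
    by rewrite -cxy -(pc x) -e pc.
  by rewrite pc cxy -e pc.
congr (_ :: _); first by rewrite permM tpermL.
rewrite -ps; apply/eq_in_map => t ts; rewrite permM tpermD //.
  by apply: contraNneq xs => /perm_inj ->.
by apply: contraNneq ys => ->; rewrite -ps map_f.
Qed.

Lemma img_act p s Q : img s (map (act p) Q) = img (p * s)%g Q.
Proof.
rewrite /img -map_comp; apply: eq_map => e /=.
by apply/ffunP => k; rewrite !ffunE permM.
Qed.

Lemma Val_act p Q : p \in colperm -> Val (map (act p) Q) = Val Q.
Proof.
move=> /colpermP pc; rewrite /Val.
rewrite -[RHS](avg_reindex (h := fun s => (p * s)%g)); last first.
- move=> s; apply/colpermP/colpermP => h t; last by rewrite permM h pc.
  by have := h ((p^-1)%g t); rewrite permM permKV => ->; rewrite -{2}(permKV p t) pc.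
- exact: mulgI.
by apply: eq_avg => s _; rewrite img_act.
Qed.

(** Two families of disjoint blocks with the same sequence of colours differ by a colour-preserving
    permutation, which the average absorbs. *)
Lemma Val_colors Q1 Q2 : uniq (slots Q1) -> uniq (slots Q2) ->
  map c (slots Q1) = map c (slots Q2) -> Val Q1 = Val Q2.
Proof.
move=> u1 u2 cc; have [p pc pQ] := colperm_extend u1 u2 cc.
by rewrite -(Val_act Q1 pc); congr Val; apply: slots_inj; rewrite slots_act.
Qed.

Lemma Val_perm Q1 Q2 : perm_eq Q1 Q2 -> Val Q1 = Val Q2.
Proof. by move=> QQ; apply: eq_avg => s _; apply: EL_perm; exact: perm_map. Qed.

Lemma Val_cat_dist Q1 Q2 : `|Val (Q1 ++ Q2) - Val Q2| <= (size Q1)%:R * lip M.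
Proof.
apply: avg_dist colperm_gt0 _ => s _; rewrite /img map_cat.
by apply: le_trans (EL_cat_dist _ _ _) _; rewrite size_map.
Qed.

Lemma Val_cons_dist e Q : `|Val (e :: Q) - Val Q| <= lip M.
Proof. by have := Val_cat_dist [:: e] Q; rewrite mul1r. Qed.

Definition free Q b : {set T} := [set t | (t \notin slots Q) && (c t == b)].
(** The entries range independently, as [kpos] requires, so a tuple may repeat a point;
    [boxes_noninj] bounds how often this happens. *)
Definition boxes Q (j : 'I_K -> bool) : {set tup} :=
  [set e : tup | [forall k : 'I_K, e k \in free Q (j k)]].

Lemma boxesP Q j e : reflect (forall k, e k \in free Q (j k)) (e \in boxes Q j).
Proof. by rewrite inE; exact: forallP. Qed.

Lemma wsum_boxes Q j (l : tup -> R) :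
  wsum (fun k t => (t \in free Q (j k))%:R / #|free Q (j k)|%:R) l = avg (boxes Q j) l.
Proof.
have card_boxes : #|boxes Q j| = (\prod_k #|free Q (j k)|)%N.
  by rewrite /boxes cardsE (card_family (fun k => mem (free Q (j k)))) foldrE big_map -big_enum.
rewrite /avg /wsum mulr_suml [RHS]big_mkcond /=; apply: eq_bigr => e _.
rewrite big_split /= -natr_prod prodfV -natr_prod -card_boxes.
case: boxesP => [h|h].
  by rewrite (eq_bigr (fun=> 1)) ?big1_eq ?mul1r ?[_^-1 * _]mulrC // => k _; rewrite h.
have [k ek] : exists k, e k \notin free Q (j k).
  by apply/existsP; rewrite -negb_forall; apply/negP => /forallP.
by rewrite (bigD1 k) //= (negbTE ek) !mul0r.
Qed.

Lemma kpos_EL (A : finType) (G : {ffun 'I_K -> A} -> {ffun {ffun V -> 'I_(pq M)} -> R} -> R)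
    (E : seq {ffun 'I_K -> V}) U :
  (forall W, kpos (G^~ W)) -> kpos (fun x => EL (M := M) (G x) E U).
Proof.
move=> Gp; elim: E U => [|v E IH] U /=; first exact: Gp.
have n0 : 0 <= #|[set: pL M]|%:R^-1 :> R by rewrite invr_ge0.
apply: eq_kpos (kposZ n0 (kpos_sum (fun a => IH (U + edge a v)))) => x.
by rewrite /avg mulrC; congr (_ * _); apply: eq_bigl => a; rewrite inE.
Qed.

Lemma EL_loss (g h : {ffun {ffun V -> 'I_(pq M)} -> R} -> R) x E U :
  EL (M := M) (fun W => g W + x - h W) E U = EL g E U + x - EL h E U.
Proof.
elim: E U => //= v E IH U.
rewrite (eq_avg (g := fun a => EL g E (U + edge a v) + x - EL h E (U + edge a v))) //.
by rewrite avgB avgD avg_const ?label_gt0.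
Qed.

(** For each permutation and each choice of the other labels this is the loss of [kpos_loss] at a
    fixed energy, and the cone is closed under mixtures. *)
Lemma kpos_Val Q : kpos (fun e => Val Q + pbase M - Val (e :: Q)).
Proof.
have n0 : 0 <= #|colperm|%:R^-1 :> R by rewrite invr_ge0.
pose l s e := EL (fun W => hmax W + pbase M - EL (@hmax R M V) [:: [ffun k => own (s (e k))]] W)
  (img s Q) U0.
have lp s : kpos (fun e => (s \in colperm)%:R * l s e).
  by apply: kposZ; [exact: ler0n | apply: kpos_EL => W; exact: (kpos_loss _ (own \o s))].
apply: eq_kpos (kposZ n0 (kpos_sum lp)) => e.
transitivity (avg colperm (fun s => l s e)).
  rewrite /avg mulrC [in RHS]big_mkcond /=; congr (_ * _); apply: eq_bigr => s _.
  by case: ifP; rewrite ?mul1r ?mul0r.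
rewrite /l (eq_avg (fun s _ => EL_loss _ _ _ _ _)) avgB avgD avg_const ?colperm_gt0 //.
by congr (_ - _); apply: eq_avg => s _; rewrite [img s (e :: Q)]/= EL_rcons.
Qed.

(** [kpos_Val] tested on the uniform laws of the free points of the colours [j k]. The value enters
    the loss with a minus sign, which reverses the inequality, and the constant cancels because the
    K weights sum to 1. *)
Lemma avg_boxes_Val Q (j : 'I_K -> bool) : (forall b, 0 < #|free Q b|)%N ->
  K%:R^-1 * \sum_i avg (boxes Q (fun=> j i)) (fun e => Val (e :: Q)) <=
  avg (boxes Q j) (fun e => Val (e :: Q)).
Proof.
move=> f0.
have box0 j' : (0 < #|boxes Q j'|)%N.
  have h k : {t | t \in free Q (j' k)} by apply/sigW/card_gt0P.
  by apply/card_gt0P; exists [ffun k => sval (h k)]; apply/boxesP => k; rewrite ffunE; case: (h k).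
have mu0 k t : 0 <= (t \in free Q (j k))%:R / #|free Q (j k)|%:R :> R.
  by rewrite divr_ge0 ?ler0n.
have := kpos_Val Q mu0; rewrite wsum_boxes.
under [X in _ <= _ * X -> _]eq_bigr => i _ do
  rewrite (wsum_boxes Q (fun=> j i)) avgB avg_const ?box0 //.
have KK (x : R) : K%:R^-1 * (x *+ K) = x.
  by rewrite -[x *+ K]mulr_natl mulKf // pnatr_eq0 -lt0n pK_gt0.
by rewrite avgB avg_const ?box0 // sumrB sumr_const card_ord mulrBr KK; lra.
Qed.

(** When entries [k] and [l] coincide, entry [k] is redundant: overwriting it by an arbitrary free
    point of its colour is an injection into the box. *)
Lemma boxes_collide Q j k l : k != l ->
  (#|[set e : tup in boxes Q j | e k == e l]| * #|free Q (j k)| <= #|boxes Q j|)%N.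
Proof.
move=> kl; rewrite -cardsX.
pose put (z : tup * T) : tup := [ffun i => if i == k then z.2 else z.1 i].
have put_inj : {in setX [set e : tup in boxes Q j | e k == e l] (free Q (j k)) &, injective put}.
  move=> [e1 t1] [e2 t2]; rewrite !inE /= => /andP[/andP[_ /eqP h1] _] /andP[/andP[_ /eqP h2] _] E.
  have Ei i := congr1 (fun f : tup => f i) E.
  congr pair; last by have := Ei k; rewrite !ffunE eqxx.
  have off i : i != k -> e1 i = e2 i by move=> ik; have := Ei i; rewrite !ffunE (negbTE ik).
  apply/ffunP => i; have [->|/off //] := eqVneq i k.
  by rewrite h1 h2 off // eq_sym.
rewrite -(card_in_imset put_inj); apply/subset_leq_card/subsetP => e /imsetP[[e1 t1]].
rewrite in_setX !inE /= => /andP[/andP[/forallP b1 _] t1f] ->.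
apply/forallP => i; rewrite ffunE; case: eqP => [->|_]; last exact: b1.
by move: t1f; rewrite !inE.
Qed.

Lemma boxes_noninj Q j (f : nat) : (forall b, f <= #|free Q b|)%N ->
  (#|[set e : tup in boxes Q j | ~~ injectiveb e]| * f <= K ^ 2 * #|boxes Q j|)%N.
Proof.
move=> ff.
have sub : [set e : tup in boxes Q j | ~~ injectiveb e] \subset
   \bigcup_(z : 'I_K * 'I_K | z.1 != z.2) [set e : tup in boxes Q j | e z.1 == e z.2].
  apply/subsetP => e; rewrite inE => /andP[eb /injectivePn[k [l kl ekl]]].
  by apply/bigcupP; exists (k, l) => //; rewrite inE eb ekl eqxx.
apply: leq_trans (leq_mul (subset_leq_card sub) (leqnn f)) _.
apply: leq_trans (leq_mul (card_bigcup_le _ _) (leqnn f)) _.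
have -> : (K ^ 2 * #|boxes Q j| = \sum_(z : 'I_K * 'I_K) #|boxes Q j|)%N.
  by rewrite sum_nat_const card_prod card_ord mulnn.
rewrite big_distrl /= big_mkcond; apply: leq_sum => z _; case: ifP => // zz.
apply: leq_trans (boxes_collide Q j zz).
by rewrite leq_mul2l ff orbT.
Qed.

Lemma uniq_slots_box Q j e : uniq (slots Q) -> e \in boxes Q j -> injectiveb e ->
  uniq (slots (e :: Q)).
Proof.
move=> uQ /boxesP eb ei; rewrite /slots /= cat_uniq uQ andbT; apply/andP; split.
  exact: ei.
apply/hasPn => t tQ; apply/negP => /codomP[k tk].
by have := eb k; rewrite inE -tk -/(slots Q) tQ.
Qed.

(** Injective tuples of the box have the colours of [e0], hence the same value. The others form a
    proportion of at most [K ^ 2 / f], and for them both values are within [lip M] of [Val Q]. *)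
Lemma avg_boxes_dist Q j e0 (f : nat) : (0 < f)%N -> (forall b, f <= #|free Q b|)%N ->
  uniq (slots (e0 :: Q)) -> (forall k, c (e0 k) = j k) ->
  `|avg (boxes Q j) (fun e => Val (e :: Q)) - Val (e0 :: Q)| <= 2 * lip M * K%:R ^+ 2 / f%:R.
Proof.
move=> f0 ff u0 cj.
have uQ : uniq (slots Q) by move: u0; rewrite /slots /= cat_uniq => /and3P[].
have e0b : e0 \in boxes Q j.
  apply/boxesP => k; rewrite inE cj eqxx andbT.
  move: u0; rewrite /slots /= cat_uniq => /and3P[_ /hasPn h _].
  by apply/negP => /h /=; rewrite codom_f.
have b0 : (0 < #|boxes Q j|)%N by apply/card_gt0P; exists e0.
have b0R : 0 < #|boxes Q j|%:R :> R by rewrite ltr0n.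
have f0R : 0 < f%:R :> R by rewrite ltr0n.
rewrite -[X in _ - X](avg_const _ b0) -avgB /avg normrM normfV (gtr0_norm b0R).
rewrite ler_pdivrMr //; apply: le_trans (ler_norm_sum _ _ _) _.
have -> : \sum_(e in boxes Q j) `|Val (e :: Q) - Val (e0 :: Q)| =
    \sum_(e in [set e : tup in boxes Q j | ~~ injectiveb e]) `|Val (e :: Q) - Val (e0 :: Q)|.
  rewrite (bigID (fun e => ~~ injectiveb e)) /= [X in _ + X]big1 ?addr0.
    by apply: eq_bigl => e; rewrite [in RHS]inE.
  move=> e /andP[eb]; rewrite negbK => ei; apply/eqP; rewrite normr_eq0 subr_eq0; apply/eqP.
  apply: Val_colors => //; first exact: uniq_slots_box eb ei.
  rewrite /slots /= !map_cat; congr (_ ++ _).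
  rewrite /codom /image_mem -!map_comp; apply: eq_map => k /=.
  by rewrite cj; have /boxesP/(_ k) := eb; rewrite inE => /andP[_ /eqP].
apply: le_trans (ler_sum (G := fun=> 2 * lip M) _ _) _.
  move=> e _; apply: le_trans (ler_distD (Val Q) _ _) _.
  by rewrite mulrDl mul1r lerD ?Val_cons_dist // distrC Val_cons_dist.
rewrite sumr_const -[_ *+ _]mulr_natr -!mulrA ler_wpM2l // ler_wpM2l ?lip_ge0 //.
have -> : K%:R * (K%:R * (f%:R^-1 * #|boxes Q j|%:R)) =
    K%:R ^+ 2 * #|boxes Q j|%:R / f%:R :> R by ring.
rewrite ler_pdivlMr // -natrX -!natrM ler_nat.
by rewrite boxes_noninj.
Qed.

(* Replace a mixed edge by a monochromatic one, of each colour with the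
   frequency at which the mixed edge meets that colour. *)
Lemma Val_split_edge Q e0 (em : bool -> tup) (f : nat) :
  (0 < f)%N -> (forall b, f <= #|free Q b|)%N -> uniq (slots (e0 :: Q)) ->
  (forall b, uniq (slots (em b :: Q))) -> (forall b k, c (em b k) = b) ->
  K%:R^-1 * (\sum_i Val (em (c (e0 i)) :: Q)) - 4 * lip M * K%:R ^+ 2 / f%:R
    <= Val (e0 :: Q).
Proof.
move=> f0 ff u0 um cm; pose j k := c (e0 k).
have f0' b : (0 < #|free Q b|)%N by apply: leq_trans (ff b).
have B := avg_boxes_Val j f0'.
have /ler_normlP[A1 A2] := avg_boxes_dist f0 ff u0 (fun k => erefl (j k)).
(* The error [z] is paid twice: to pass from [e0] to its box, and from the monochromatic boxes to
   the edges [em]. *)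
set z := 2 * lip M * K%:R ^+ 2 / f%:R in A1 A2.
have C : K%:R^-1 * (\sum_i Val (em (j i) :: Q)) - z <=
    K%:R^-1 * (\sum_i avg (boxes Q (fun=> j i)) (fun e => Val (e :: Q))).
  have Kn : K%:R != 0 :> R by rewrite pnatr_eq0 -lt0n pK_gt0.
  have -> : z = K%:R^-1 * \sum_(i < K) z.
    by rewrite sumr_const card_ord -[z *+ K]mulr_natl mulKf.
  rewrite -mulrBr -sumrB ler_wpM2l ?invr_ge0 ?ler0n // ler_sum // => i _.
  by have /ler_normlP[+ _] := avg_boxes_dist (j := fun=> j i) f0 ff (um (j i)) (cm (j i)); rewrite -/z; lra.
have -> : 4 * lip M * K%:R ^+ 2 / f%:R = z + z by rewrite /z; ring.
by move: B C A1 A2; rewrite -/j; lra.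
Qed.

End Interpolation.

(** * From mixed to monochromatic edges *)

Section Splitting.
Variables (R : realType) (M : penalty_model R) (V T : finType) (own : T -> V).
Variables (U0 : {ffun {ffun V -> 'I_(pq M)} -> R}) (c : T -> bool).
Local Notation K := (pK M).
Local Notation tup := {ffun 'I_K -> T}.
Local Notation Val := (Val own U0 c).
Local Notation free := (free c).
Implicit Types (e : tup) (Q : seq tup) (s : {perm T}) (b : bool).

Definition nf Q b : nat := #|free Q b|.
Definition hits e b : nat := #|[set k | c (e k) == b]|.
Definition mono b e : bool := [forall k, c (e k) == b].
Definition ismono e : bool := mono true e || mono false e.

Lemma monoP b e : reflect (forall k, c (e k) = b) (mono b e).
Proof. by apply: (iffP forallP) => h k; apply/eqP. Qed.

Lemma mono_hits b b' e : mono b e -> hits e b' = if b == b' then K else 0%N.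
Proof.
move=> /monoP h; rewrite /hits; case: ifP => bb.
  by rewrite (eq_card (B := predT)) ?card_ord // => k; rewrite inE h bb.
by apply/eqP; rewrite cards_eq0; apply/eqP/setP => k; rewrite !inE h bb.
Qed.

Lemma hits_sum e : (hits e true + hits e false = K)%N.
Proof.
rewrite -[RHS]card_ord -(cardsC [set k | c (e k) == true]); congr (_ + #|pred_of_set _|)%N.
by apply/setP => k; rewrite !inE eqb_id eqbF_neg.
Qed.

Lemma free_cons e Q b : uniq (slots (e :: Q)) -> nf Q b = (nf (e :: Q) b + hits e b)%N.
Proof.
rewrite /slots /= cat_uniq => /and3P[ue /hasPn dis _].
have ei : injective e by apply/injectiveP.
rewrite /nf /hits -(card_imset _ ei) addnC.
have -> : free Q b = (e @: [set k | c (e k) == b]) :|: free (e :: Q) b.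
  apply/setP => t; rewrite !inE /slots /= mem_cat negb_or -/(slots Q).
  apply/idP/orP => [/andP[tQ tb]|].
    case: (boolP (t \in codom e)) => [/codomP[k tk]|te]; [left|right].
      by rewrite tk imset_f // inE -tk.
    by rewrite tQ tb.
  case=> [/imsetP[k]|/andP[/andP[_ ->] -> //]].
  rewrite inE => kb ->; rewrite kb andbT; apply/negP => /dis /=.
  by rewrite codom_f.
rewrite cardsU; set X := (X in (_ + _ - #|pred_of_set X|)%N); suff -> : X = set0 by rewrite cards0 subn0.
apply/setP => t; rewrite !inE /slots /= mem_cat; apply/negP => /andP[/imsetP[k _ ->]].
by rewrite codom_f.
Qed.

Lemma uniq_slots_cons e Q : uniq (slots (e :: Q)) -> uniq (slots Q).
Proof. by rewrite /slots /= cat_uniq => /and3P[]. Qed.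

Lemma free_perm Q1 Q2 b : perm_eq Q1 Q2 -> nf Q1 b = nf Q2 b.
Proof.
by move=> /perm_slots/perm_mem QQ; apply: eq_card => t; rewrite !inE QQ.
Qed.

Lemma exists_mono Q b : (K <= nf Q b)%N -> uniq (slots Q) ->
  {e | mono b e & uniq (slots (e :: Q))}.
Proof.
move=> Kf uQ.
pose h (k : 'I_K) := enum_val (widen_ord Kf k) : T.
exists [ffun k => h k].
  by apply/monoP => k; rewrite ffunE; have := enum_valP (widen_ord Kf k); rewrite inE => /andP[_ /eqP].
apply: (uniq_slots_box (c := c) (j := fun=> b)) => //.
  by apply/boxesP => k; rewrite ffunE; exact: enum_valP.
apply/injectiveP => k l; rewrite !ffunE => /enum_val_inj /(congr1 val) /= kl.
exact: val_inj.
Qed.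

(** A lower bound for the patterns whose edges all lie inside one part; it is later taken to be the
    sum of the two separate expected maxima. *)
Variable Lst : R.
Hypothesis Lst_le : forall Q, perm_eq (slots Q) (enum T) -> all ismono Q -> Lst <= Val Q.

(** The free points of each colour can be filled by monochromatic edges thanks to divisibility; each
    of the [n] new edges changes the value by at most [lip M]. *)
Lemma local_ge n Q : uniq (slots Q) -> all ismono Q ->
  (K %| nf Q true)%N -> (K %| nf Q false)%N -> (nf Q true + nf Q false = n * K)%N ->
  Lst - n%:R * lip M <= Val Q.
Proof.
elim: n Q => [|n IH] Q uQ aQ dt df sQ.
  rewrite mul0r subr0; apply: Lst_le => //; apply: uniq_perm => //; first exact: enum_uniq.
  move=> t; rewrite mem_enum; apply/esym; case: (boolP (t \in slots Q)) => // tQ.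
  have : (0 < nf Q (c t))%N by apply/card_gt0P; exists t; rewrite inE tQ eqxx.
  by case: (c t); lia.
have [b Kb] : exists b, (K <= nf Q b)%N.
  have /dvdnP[x Ex] := dt; have /dvdnP[y Ey] := df.
  have /eqP := sQ; rewrite Ex Ey -mulnDl eqn_pmul2r ?pK_gt0 // => /eqP xy.
  case: x Ex xy => [|x] Ex xy; last by exists true; rewrite Ex mulSn leq_addr.
  by exists false; rewrite Ey -[y]add0n xy mulSn leq_addr.
have [e em ue] := exists_mono Kb uQ.
have St : (nf Q true = nf (e :: Q) true + if b == true then K else 0)%N by rewrite (free_cons _ ue) (mono_hits _ em).
have Sf : (nf Q false = nf (e :: Q) false + if b == false then K else 0)%N by rewrite (free_cons _ ue) (mono_hits _ em).
have := IH (e :: Q) ue.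
have -> : all ismono (e :: Q) by rewrite /= aQ andbT /ismono; case: (b) em => ->; rewrite ?orbT.
move: dt df sQ; rewrite St Sf; case: (b) => /=; rewrite addn0 ?dvdn_addl // => dt df sQ.
- move=> /(_ isT dt df) H; have := H ltac:(lia).
  by have /ler_normlP[] := Val_cons_dist own U0 c e Q; rewrite -natr1 mulrDl mul1r; lra.
- move=> /(_ isT dt df) H; have := H ltac:(lia).
  by have /ler_normlP[] := Val_cons_dist own U0 c e Q; rewrite -natr1 mulrDl mul1r; lra.
Qed.

Hypothesis dvdK : forall b, (K %| #|[set t | c t == b]|)%N.

Lemma nf_nil b : nf [::] b = #|[set t | c t == b]|.
Proof. by apply: eq_card => t; rewrite !inE. Qed.

Lemma card_colors : (#|[set t | c t == true]| + #|[set t | c t == false]| = #|T|)%N.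
Proof.
rewrite -(cardsC [set t | c t == true]); congr (_ + #|pred_of_set _|)%N.
by apply/setP => k; rewrite !inE eqb_id eqbF_neg.
Qed.

Lemma nf_dvd Q b : uniq (slots Q) -> all ismono Q -> (K %| nf Q b)%N.
Proof.
elim: Q => [|e Q IH] uQ; first by rewrite nf_nil dvdK.
move=> /= /andP[me aQ]; have := IH (uniq_slots_cons uQ) aQ.
rewrite (free_cons b uQ) dvdn_addl //.
by case/orP: me => /mono_hits ->; case: eqP.
Qed.

Lemma nf_size Q : uniq (slots Q) -> (nf Q true + nf Q false + size Q * K = #|T|)%N.
Proof.
elim: Q => [|e Q IH] uQ; first by rewrite !nf_nil mul0n addn0 card_colors.
have := IH (uniq_slots_cons uQ).
by rewrite !(free_cons _ uQ) /=; have := hits_sum e; lia.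
Qed.

Variable E : nat.
Hypothesis TE : #|T| = (E * K)%N.

Lemma size_le_E Q : uniq (slots Q) -> (size Q <= E)%N.
Proof.
move=> /nf_size; rewrite TE => h; rewrite -(leq_pmul2r (pK_gt0 M)); lia.
Qed.

(** Comparison through the empty pattern: at most [E] edges are removed, then [E] local ones are
    added. *)
Lemma trivial_ge Q : uniq (slots Q) -> Lst - (2 * E)%:R * lip M <= Val Q.
Proof.
move=> uQ; have := local_ge (n := E) (Q := [::]) isT isT.
rewrite !nf_dvd // => /(_ isT isT); rewrite !nf_nil card_colors => /(_ TE) H.
have /ler_normlP[] := Val_cat_dist own U0 c Q [::]; rewrite cats0.
have : (size Q)%:R * lip M <= E%:R * lip M.
  by rewrite ler_wpM2r ?lip_ge0 // ler_nat size_le_E.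
by rewrite natrM; lra.
Qed.

Variables (m0 : nat) (g : R).
Hypothesis m0K : (K <= m0)%N.

(** Here [d] is the deviation of the number of free points of colour [true] from a reference value
    and [m] the number of mixed edges left. The terms are the cost of the final [n] local edges, the
    loss of [trivial_ge] times a Chebyshev bound on the chance that the deviation reaches [m0], and
    the error of [Val_split_edge] at each step. *)
Definition slack (n : nat) (d : R) (m : nat) : R :=
  n%:R * lip M + (2 * E)%:R * lip M * (d ^+ 2 + K%:R ^+ 2 * m%:R) / m0%:R ^+ 2
  + m%:R * (4 * lip M * K%:R ^+ 2 / m0%:R).

(* Replacing mixed edges one at a time makes the number of free points of
   colour [true] a martingale; the term in d^2 pays for its excursions, so that
   the trivial bound suffices once a colour has fewer than m0 free points. *)
Lemma mixed_ge m n Q : uniq (slots Q) -> count (predC ismono) Q = m ->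
  (nf Q true + nf Q false = n * K)%N ->
  2 * m0%:R <= g -> 2 * m0%:R <= (n * K)%:R - g ->
  Lst - slack n ((nf Q true)%:R - g) m <= Val Q.
Proof.
have m0_gt0 : 0 < m0%:R :> R by rewrite ltr0n (leq_trans (pK_gt0 M)).
have l0 := lip_ge0 M.
have K0 : 0 < K%:R :> R by rewrite ltr0n pK_gt0.
elim: m Q => [|m IH] Q uQ mQ sQ g1 g2.
  have aQ : all ismono Q by rewrite all_count -(count_predC ismono Q) mQ addn0.
  have := local_ge uQ aQ (nf_dvd _ uQ aQ) (nf_dvd _ uQ aQ) sQ.
  have : 0 <= (2 * E)%:R * lip M * (((nf Q true)%:R - g) ^+ 2 + K%:R ^+ 2 * 0) / m0%:R ^+ 2.
    rewrite mulr0 addr0; apply: divr_ge0; last exact: sqr_ge0.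
    by apply: mulr_ge0; [exact: mulr_ge0 | exact: sqr_ge0].
  by rewrite /slack mulr0n mul0r; lra.
set d := _ - g.
have st0 : 0 <= m.+1%:R * (4 * lip M * K%:R ^+ 2 / m0%:R).
  apply: mulr_ge0 => //; apply: divr_ge0 => //.
  by apply: mulr_ge0; [exact: mulr_ge0 | exact: sqr_ge0].
(* If the deviation has reached [m0], the second term of [slack] alone covers the loss in
   [trivial_ge]. *)
have [far|near] := leP m0%:R `|d|.
  have := trivial_ge uQ.
  have d2 : m0%:R ^+ 2 <= d ^+ 2 by rewrite -[d ^+ 2]real_normK ?num_real // lerXn2r ?nnegrE.
  have : (2 * E)%:R * lip M <= (2 * E)%:R * lip M * (d ^+ 2 + K%:R ^+ 2 * m.+1%:R) / m0%:R ^+ 2.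
    rewrite -mulrA ler_peMr ?mulr_ge0 // ler_pdivlMr ?exprn_gt0 // mul1r.
    by rewrite (le_trans d2) // lerDl; apply: mulr_ge0; [exact: sqr_ge0 | ].
  have : 0 <= n%:R * lip M by rewrite mulr_ge0.
  by rewrite /slack; lra.
(* The reference [g] is at least [2 * m0] away from both extremes, so a deviation below [m0] leaves
   [m0] free points of each colour. *)
have fb b : (m0 <= nf Q b)%N.
  rewrite -(ler_nat R); move: near; rewrite ltr_norml => /andP[d1 d2].
  case: b; first by rewrite /d in d1; lra.
  by move: sQ => /(congr1 (fun x => x%:R : R)); rewrite natrD => sQ; rewrite /d in d2; lra.
have [e eQ em] : exists2 e, e \in Q & ~~ ismono e.
  by apply/hasP; rewrite has_count mQ.
have pQ := perm_to_rem eQ; set Q' := rem e Q in pQ.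
have ueQ : uniq (slots (e :: Q')) by rewrite -(perm_uniq (perm_slots pQ)).
have uQ' := uniq_slots_cons ueQ.
have mQ' : count (predC ismono) Q' = m.
  by move/seq.permP: pQ => /(_ (predC ismono)); rewrite mQ /= em => -[->].
have nfE b : nf Q' b = (nf Q b + hits e b)%N by rewrite (free_cons b ueQ) (free_perm b pQ).
have fb' b : (m0 <= nf Q' b)%N by rewrite nfE (leq_trans (fb b)) ?leq_addr.
have ex b := exists_mono (leq_trans m0K (fb' b)) uQ'.
pose ee b := let: exist2 x _ _ := ex b in x.
have eem b : mono b (ee b) by rewrite /ee; case: (ex b).
have eeu b : uniq (slots (ee b :: Q')) by rewrite /ee; case: (ex b).
have eec b k : c (ee b k) = b by have /monoP := eem b; apply.
have step := Val_split_edge own U0 (leq_trans (pK_gt0 M) m0K) fb' ueQ eeu eec.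
rewrite (Val_perm own U0 c pQ); apply: le_trans step.
set k := hits e true.
(* Removing [e] frees [k] points of colour [true], and the new edge uses [K] of them if its colour
   is [true] and none otherwise. *)
have IHb b : Lst - slack n (d + k%:R - K%:R * b%:R) m <= Val (ee b :: Q').
  have ismb : ismono (ee b) by rewrite /ismono; case: (b) (eem b) => ->; rewrite ?orbT.
  have nft b' := free_cons b' (eeu b).
  have -> : d + k%:R - K%:R * b%:R = (nf (ee b :: Q') true)%:R - g.
    have := nft true; rewrite nfE (mono_hits _ (eem b)) eqb_id -/k.
    move=> /(congr1 (fun x => x%:R : R)); rewrite !natrD /d.
    by case: (b) => /=; rewrite ?mulr1 ?mulr0 => H; lra.
  apply: IH => //; first by rewrite /= ismb.
  move: (nft true) (nft false) (hits_sum e) sQ; rewrite !nfE !(mono_hits _ (eem b)).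
  clear; move: (nf _ true) (nf _ false) (nf Q true) (nf Q false) (hits e true) (hits e false) (n * K)%N.
  by case: b => /= x1 x2 x3 x4 x5 x6 x7; lia.
have kK : k%:R = \sum_(i < K) (c (e i))%:R :> R.
  rewrite /k /hits -sum1_card natr_sum big_mkcond /=; apply: eq_bigr => i _.
  by rewrite inE eqb_id; case: (c _).
pose z := 4 * lip M * K%:R ^+ 2 / m0%:R.
suff : Lst - slack n d m.+1 + z <= K%:R^-1 * \sum_i Val (ee (c (e i)) :: Q') by rewrite -/z; lra.
rewrite mulrC ler_pdivlMr //; apply: le_trans (ler_sum _ (fun i _ => IHb (c (e i)))).
pose y := (2 * E)%:R * lip M / m0%:R ^+ 2.
pose x := n%:R * lip M + y * ((d + k%:R) ^+ 2 + K%:R ^+ 2 * m%:R) + m%:R * z.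
have y0 : 0 <= y by apply: divr_ge0; [exact: mulr_ge0 | exact: sqr_ge0].
(* Since [b] is 0 or 1, its square is [b], and the slack is affine in [b]; its average over the
   entries of [e] then only needs their sum [k]. *)
have slE b : slack n (d + k%:R - K%:R * b%:R) m =
    x + y * (K%:R ^+ 2 - 2 * K%:R * (d + k%:R)) * b%:R.
  by rewrite /slack /x /y /z; case: b => /=; ring.
under eq_bigr => i _ do rewrite slE opprD addrA.
rewrite sumrB -mulr_sumr -kK sumr_const card_ord -[_ *+ K]mulr_natr.
have -> : Lst - slack n d m.+1 + z = Lst - x + y * (2 * d * k%:R + k%:R ^+ 2 - K%:R ^+ 2).
  by rewrite /slack /x /y /z -natr1; ring.
(* The increment has mean 0 and second moment [k * (K - k)]; the budget [K ^ 2] per step exceeds it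
   by [k ^ 2 + K * (K - k)]. *)
have pos : 0 <= y * K%:R * (k%:R ^+ 2 + K%:R * (K%:R - k%:R)) :> R.
  apply: mulr_ge0; first by apply: mulr_ge0 => //; exact: ltW.
  apply: addr_ge0; first exact: sqr_ge0.
  apply: mulr_ge0; first exact: ltW.
  by rewrite subr_ge0 ler_nat -(hits_sum e) leq_addr.
rewrite -subr_ge0; apply: le_trans pos _; rewrite le_eqVlt; apply/orP; left; apply/eqP.
ring.
Qed.

End Splitting.

Lemma split_count (A : eqType) (h : pred A) (Q : seq A) t : (t <= count h Q)%N ->
  exists Q1 Q2, [/\ perm_eq Q (Q1 ++ Q2), size Q1 = t & all h Q1].
Proof.
move=> tQ; exists (take t (filter h Q)), (drop t (filter h Q) ++ filter (predC h) Q).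
split.
- by rewrite catA cat_take_drop perm_sym; apply/permPl/perm_filterC.
- by rewrite size_take size_filter; case: ltngtP tQ => // ->.
- by apply/allP => x /mem_take; rewrite mem_filter => /andP[].
Qed.

Section FullPatterns.
Variables (R : realType) (M : penalty_model R) (V T : finType) (own : T -> V).
Variables (U0 : {ffun {ffun V -> 'I_(pq M)} -> R}) (c : T -> bool).
Local Notation K := (pK M).
Local Notation tup := {ffun 'I_K -> T}.
Local Notation Val := (Val own U0 c).
Implicit Types (e : tup) (Q : seq tup) (b : bool).

Definition meets b e : bool := (0 < hits c e b)%N.

Lemma nf_cat Q1 Q2 b : uniq (slots (Q1 ++ Q2)) ->
  (count (meets b) Q1 + nf c (Q1 ++ Q2) b <= nf c Q2 b)%N.
Proof.
elim: Q1 => //= e Q1 IH uQ; have := IH (uniq_slots_cons uQ).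
by rewrite (free_cons c b uQ) /meets; case: (posnP (hits c e b)) => /=; lia.
Qed.

Lemma nf_count Q b : uniq (slots Q) ->
  (nf c ([::] : seq tup) b <= nf c Q b + count (meets b) Q * K)%N.
Proof.
elim: Q => [|e Q IH] uQ; first by rewrite leq_addr.
apply: leq_trans (IH (uniq_slots_cons uQ)) _; rewrite (free_cons c b uQ) /= mulnDl.
rewrite -addnA leq_add2l leq_add2r /meets; case: (posnP (hits c e b)) => [->//|_].
by rewrite /= mul1n -[X in (_ <= X)%N]card_ord max_card.
Qed.

Variable Lst : R.
Hypothesis Lst_le : forall Q, perm_eq (slots Q) (enum T) -> all (ismono c) Q -> Lst <= Val Q.
Hypothesis dvdK : forall b, (K %| #|[set t | c t == b]|)%N.
Variable E : nat.
Hypothesis TE : #|T| = (E * K)%N.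

Lemma full_uniq Q : perm_eq (slots Q) (enum T) -> uniq (slots Q).
Proof. by move/perm_uniq ->; exact: enum_uniq. Qed.

Lemma full_nf Q b : perm_eq (slots Q) (enum T) -> nf c Q b = 0%N.
Proof.
move=> fQ; apply/eqP; rewrite cards_eq0; apply/eqP/setP => t.
by rewrite !inE (perm_mem fQ) mem_enum.
Qed.

Lemma full_size Q : perm_eq (slots Q) (enum T) -> size Q = E.
Proof.
move=> fQ; have := nf_size c (full_uniq fQ); rewrite !full_nf // TE => /eqP.
by rewrite eqn_pmul2r ?pK_gt0 // => /eqP.
Qed.

(** At most one edge per point of colour [false] meets that colour. These edges are discarded and
    replaced by as many local ones, whence the factor 2. *)
Lemma full_ge_trivial Q : perm_eq (slots Q) (enum T) ->
  Lst - 2 * #|[set t | c t == false]|%:R * lip M <= Val Q.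
Proof.
move=> fQ; set Q1 := filter (predC (mono c true)) Q; set Q2 := filter (mono c true) Q.
have QQ : perm_eq Q (Q1 ++ Q2).
  by rewrite perm_sym perm_catC; apply/permPl/perm_filterC.
have u12 : uniq (slots (Q1 ++ Q2)) by rewrite -(perm_uniq (perm_slots QQ)) full_uniq.
have u2 : uniq (slots Q2).
  by move: u12; rewrite /slots map_cat flatten_cat cat_uniq => /and3P[].
have a2 : all (ismono c) Q2.
  by apply/allP => e; rewrite mem_filter /ismono => /andP[->].
have s1 : (size Q1 <= #|[set t | c t == false]|)%N.
  have := @nf_cat Q [::] false; rewrite cats0 => /(_ (full_uniq fQ)).
  rewrite full_nf // addn0 nf_nil; apply: leq_trans; rewrite size_filter.
  apply: sub_count => e /= /forallPn[k]; rewrite /meets /hits => ck.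
  by apply/card_gt0P; exists k; rewrite inE eqbF_neg; move: ck; case: (c _).
have s2 : (nf c Q2 true + nf c Q2 false = size Q1 * K)%N.
  have := nf_size c u2; have := full_size fQ; rewrite (perm_size QQ) size_cat TE => <-.
  by rewrite mulnDl => /eqP; rewrite eqn_add2r => /eqP.
have := local_ge Lst_le u2 a2 (nf_dvd dvdK _ u2 a2) (nf_dvd dvdK _ u2 a2) s2.
have /ler_normlP[] := Val_cat_dist own U0 c Q1 Q2; rewrite -(Val_perm own U0 c QQ).
have : (size Q1)%:R * lip M <= #|[set t | c t == false]|%:R * lip M.
  by rewrite ler_wpM2r ?lip_ge0 // ler_nat.
by lra.
Qed.

(** Discarding [2 * m0] edges that meet each colour frees at least [2 * m0] points of each.
    [mixed_ge] is then started at deviation 0; the [4 * m0] discarded edges and the [4 * m0] final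
    ones give the term [8 * m0]. *)
Lemma full_ge m0 Q : (K <= m0)%N -> (forall b, 4 * m0 * K <= #|[set t | c t == b]|)%N ->
  perm_eq (slots Q) (enum T) ->
  Lst - lip M * (8 * m0%:R + 2 * E%:R * K%:R ^+ 2 * (E%:R / m0%:R ^+ 2)
                 + 4 * K%:R ^+ 2 * (E%:R / m0%:R)) <= Val Q.
Proof.
move=> Km0 big fQ.
have cnt b : (4 * m0 <= count (meets b) Q)%N.
  have := nf_count b (full_uniq fQ); rewrite nf_nil full_nf // add0n => h.
  by rewrite -(leq_pmul2r (pK_gt0 M)); exact: leq_trans (big b) h.
have [|Q1 [Q2 [p12 s1 a1]]] := @split_count _ (meets true) Q (2 * m0).
  by apply: leq_trans (cnt true); rewrite leq_mul2r orbT.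
(* Edges of [Q1] may meet both colours; of the [4 * m0] edges meeting [false], at least [2 * m0]
   remain after its removal. *)
have [|Q3 [Q4 [p34 s3 a3]]] := @split_count _ (meets false) Q2 (2 * m0).
  have := cnt false; have /seq.permP/(_ (meets false)) := p12; rewrite count_cat => ->.
  have : (count (meets false) Q1 <= 2 * m0)%N by rewrite -s1 count_size.
  by move: (count _ Q1) (count _ Q2) => x y; clear; lia.
have QQ : perm_eq Q ((Q1 ++ Q3) ++ Q4).
  by apply: perm_trans p12 _; rewrite -catA perm_cat2l.
have u : uniq (slots ((Q1 ++ Q3) ++ Q4)) by rewrite -(perm_uniq (perm_slots QQ)) full_uniq.
have u4 : uniq (slots Q4).
  by move: u; rewrite /slots map_cat flatten_cat cat_uniq => /and3P[].
have f4 b : (2 * m0 <= nf c Q4 b)%N.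
  apply: leq_trans (nf_cat b u); apply: leq_trans (leq_addr _ _); rewrite count_cat.
  case: b; first by apply: leq_trans (leq_addr _ _); move: a1; rewrite all_count s1 => /eqP ->.
  by apply: leq_trans (leq_addl _ _); move: a3; rewrite all_count s3 => /eqP ->.
have sz : (nf c Q4 true + nf c Q4 false = (4 * m0) * K)%N.
  have := nf_size c u4; have := full_size fQ; rewrite (perm_size QQ) !size_cat s1 s3 TE => <-.
  by rewrite mulnDl => /eqP; rewrite eqn_add2r => /eqP ->; congr (_ * _)%N; lia.
have E4 : (count (predC (ismono c)) Q4 <= E)%N.
  by apply: leq_trans (count_size _ _) _; rewrite (size_le_E _ TE u4).
set g : R := (nf c Q4 true)%:R.
have g1 : 2 * m0%:R <= g by rewrite -natrM ler_nat f4.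
have g2 : 2 * m0%:R <= (4 * m0 * K)%:R - g.
  by rewrite -sz natrD addrC addKr -natrM ler_nat f4.
have := mixed_ge Lst_le dvdK TE Km0 u4 erefl sz g1 g2.
have /ler_normlP[] := Val_cat_dist own U0 c (Q1 ++ Q3) Q4; rewrite -(Val_perm own U0 c QQ).
rewrite size_cat s1 s3 /slack subrr expr0n add0r.
set m := count _ _ in E4 *.
have mE : m%:R <= E%:R :> R by rewrite ler_nat.
have l0 := lip_ge0 M.
have b1 : (2 * E)%:R * lip M * (K%:R ^+ 2 * m%:R) / m0%:R ^+ 2 <=
          lip M * (2 * E%:R * K%:R ^+ 2 * (E%:R / m0%:R ^+ 2)).
  have -> : lip M * (2 * E%:R * K%:R ^+ 2 * (E%:R / m0%:R ^+ 2)) =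
    ((2 * E)%:R * lip M * (K%:R ^+ 2 * E%:R)) / m0%:R ^+ 2 by rewrite natrM; ring.
  rewrite ler_wpM2r ?invr_ge0 ?exprn_ge0 // ler_wpM2l //; first exact: mulr_ge0.
  by rewrite ler_wpM2l // exprn_ge0.
have b2 : m%:R * (4 * lip M * K%:R ^+ 2 / m0%:R) <= lip M * (4 * K%:R ^+ 2 * (E%:R / m0%:R)).
  have -> : lip M * (4 * K%:R ^+ 2 * (E%:R / m0%:R)) =
     E%:R * (4 * lip M * K%:R ^+ 2 / m0%:R) by ring.
  rewrite ler_wpM2r //; apply: divr_ge0 => //; apply: mulr_ge0; first exact: mulr_ge0.
  exact: exprn_ge0.
have -> : (2 * m0 + 2 * m0)%:R = 4 * m0%:R :> R by rewrite natrD natrM; ring.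
have -> : (4 * m0)%:R = 4 * m0%:R :> R by rewrite natrM.
rewrite ![lip M * (_ + _)]mulrDr.
set B1 := lip M * (2 * E%:R * K%:R ^+ 2 * (E%:R / m0%:R ^+ 2)) in b1 *.
set B2 := lip M * (4 * K%:R ^+ 2 * (E%:R / m0%:R)) in b2 *.
set A1 := (2 * E)%:R * lip M * (K%:R ^+ 2 * m%:R) / m0%:R ^+ 2 in b1 *.
set A2 := m%:R * (4 * lip M * K%:R ^+ 2 / m0%:R) in b2 *.
by move: b1 b2; clearbody A1 A2 B1 B2; lra.
Qed.

End FullPatterns.

(** * Near superadditivity of the expected maximum *)

Section RestrictPerm.
Variables (T1 T : finType) (i : T1 -> T) (c : T -> bool) (b : bool).
Hypothesis i_inj : injective i.
Hypothesis c_i : forall u, c (i u) = b.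
Hypothesis i_c : forall t, c t = b -> exists u, t = i u.

(** The permutation induced on the class of colour [b]; the default [1] is not reached when [s]
    preserves the colours. *)
Definition restr (s : {perm T}) : {perm T1} :=
  odflt 1%g [pick p : {perm T1} | [forall u, s (i u) == i (p u)]].

Lemma restrP s : s \in colperm c -> forall u, s (i u) = i (restr s u).
Proof.
move=> /colpermP sc; rewrite /restr; case: pickP => [p /forallP h u|no]; first exact/eqP.
have ex u : exists v, s (i u) == i v.
  by have [v ->] := i_c (etrans (sc (i u)) (c_i u)); exists v.
have f_inj : injective (fun u => xchoose (ex u)).
  move=> u v uv; apply: i_inj; apply: (@perm_inj _ s).
  by rewrite (eqP (xchooseP (ex u))) (eqP (xchooseP (ex v))) uv.
have /negP[] := negbT (no (perm f_inj)); apply/forallP => u.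
by rewrite permE; exact: (xchooseP (ex u)).
Qed.

Definition lift_fun (p : {perm T1}) (t : T) : T :=
  if [pick u | i u == t] is Some u then i (p u) else t.

Lemma lift_fun_i p u : lift_fun p (i u) = i (p u).
Proof.
rewrite /lift_fun; case: pickP => [v /eqP/i_inj -> //|/(_ u)]; by rewrite eqxx.
Qed.

Lemma lift_fun_out p t : c t != b -> lift_fun p t = t.
Proof.
by rewrite /lift_fun => ct; case: pickP => // u /eqP ut; rewrite -ut c_i eqxx in ct.
Qed.

Lemma lift_fun_col p t : c (lift_fun p t) = c t.
Proof.
have [/i_c[u ->]|ct] := eqVneq (c t) b; first by rewrite lift_fun_i !c_i.
by rewrite lift_fun_out.
Qed.

Lemma lift_fun_inj p : injective (lift_fun p).
Proof.
move=> t1 t2 E; have := congr1 c E; rewrite !lift_fun_col => cc.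
have [h|h] := eqVneq (c t1) b; last by move: E; rewrite !lift_fun_out // -cc.
have [u1 E1] := i_c h; have [u2 E2] := i_c (etrans (esym cc) h).
by move: E; rewrite E1 E2 !lift_fun_i => /i_inj/perm_inj ->.
Qed.

Definition lift_perm1 p : {perm T} := perm (@lift_fun_inj p).

(** Multiplying [s] by the lift of a uniform permutation [p] stays in [colperm c] and multiplies the
    restriction by [p], so the restriction is uniform. *)
Lemma avg_restr (R : realType) (F : {perm T1} -> R) :
  avg (colperm c) (fun s => F (restr s)) = avg [set: {perm T1}] F.
Proof.
have pT : (0 < #|[set: {perm T1}]|)%N by apply/card_gt0P; exists 1%g; rewrite inE.
have lc p : forall t, c (lift_perm1 p t) = c t by move=> t; rewrite permE lift_fun_col.
have mulc p s : ((lift_perm1 p * s)%g \in colperm c) = (s \in colperm c).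
  apply/colpermP/colpermP => h t; last by rewrite permM h lc.
  have := h ((lift_perm1 p)^-1 t)%g; rewrite permM permKV => ->.
  by rewrite -(lc p) permKV.
rewrite (@avg_double _ _ _ _ [set: {perm T1}] (fun p s => lift_perm1 p * s)%g) //.
- rewrite -[RHS](avg_const _ (colperm_gt0 c)); apply: eq_avg => s sc.
  rewrite -[RHS](avg_reindex (h := fun p => (p * restr s)%g)); last first.
  + by move=> p; rewrite !inE.
  + exact: mulIg.
  apply: eq_avg => p _; congr F; apply/permP => u; apply: i_inj.
  by rewrite -(restrP (etrans (mulc p s) sc)) !permM permE lift_fun_i (restrP sc).
- by move=> p _; exact: mulgI.
Qed.

End RestrictPerm.

Section SplitEnergy.
Variables (R : realType) (M : penalty_model R) (n1 n2 : nat).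
Local Notation K := (pK M).
Local Notation q := (pq M).
Local Notation energy n := {ffun {ffun 'I_n -> 'I_q} -> R}.

Definition comb (U1 : energy n1) (U2 : energy n2) : energy (n1 + n2) :=
  [ffun x : {ffun 'I_(n1 + n2) -> 'I_q} =>
    U1 [ffun v => x (lshift n2 v)] + U2 [ffun v => x (rshift n1 v)]].

Lemma hmax_comb U1 U2 : hmax (comb U1 U2) = hmax U1 + hmax U2.
Proof.
apply/eqP; rewrite eq_le; apply/andP; split.
  by apply: hmax_le => x; rewrite ffunE lerD ?hmax_ge.
have [x1 ->] := hmax_attained U1; have [x2 ->] := hmax_attained U2.
pose x : {ffun 'I_(n1 + n2) -> 'I_q} :=
  [ffun v => match split v with inl a => x1 a | inr b => x2 b end].
apply: le_trans (hmax_ge _ x); rewrite ffunE.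
have -> : [ffun v => x (lshift n2 v)] = x1.
  by apply/ffunP => v; rewrite !ffunE (unsplitK (inl v)).
have -> // : [ffun v => x (rshift n1 v)] = x2.
by apply/ffunP => v; rewrite !ffunE (unsplitK (inr v)).
Qed.

Lemma comb_l U1 U2 a (e : {ffun 'I_K -> 'I_n1}) :
  comb U1 U2 + edge a [ffun k => lshift n2 (e k)] = comb (U1 + edge a e) U2.
Proof.
apply/ffunP => x; rewrite !ffunE addrAC; congr (_ + (_ - _ * (nat_of_bool (pbad _ _))%:R) + _).
by apply: eq_map => k; rewrite !ffunE.
Qed.

Lemma comb_r U1 U2 a (e : {ffun 'I_K -> 'I_n2}) :
  comb U1 U2 + edge a [ffun k => rshift n1 (e k)] = comb U1 (U2 + edge a e).
Proof.
apply/ffunP => x; rewrite !ffunE -addrA; congr (_ + (_ + (_ - _ * (nat_of_bool (pbad _ _))%:R))).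
by apply: eq_map => k; rewrite !ffunE.
Qed.

Lemma EL_comb (Q1 : seq {ffun 'I_K -> 'I_n1}) (Q2 : seq {ffun 'I_K -> 'I_n2}) U1 U2 :
  EL (@hmax R M _) ([seq [ffun k => lshift n2 (e k)] | e : {ffun 'I_K -> 'I_n1} <- Q1] ++
            [seq [ffun k => rshift n1 (e k)] | e : {ffun 'I_K -> 'I_n2} <- Q2]) (comb U1 U2)
  = EL (@hmax R M _) Q1 U1 + EL (@hmax R M _) Q2 U2.
Proof.
elim: Q1 U1 => [|e Q1 IH] U1 /=.
  elim: Q2 U2 => [|e Q2 IH] U2 /=; first exact: hmax_comb.
  rewrite (eq_avg (g := fun a => hmax U1 + EL (@hmax R M _) Q2 (U2 + edge a e))).
    by rewrite avgD avg_const ?label_gt0.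
  by move=> a _; rewrite comb_r IH.
rewrite (eq_avg (g := fun a => EL (@hmax R M _) Q1 (U1 + edge a e) + EL (@hmax R M _) Q2 U2)).
  by rewrite avgD (avg_const _ (label_gt0 M)).
by move=> a _; rewrite comb_l IH.
Qed.

Definition node_energy n : energy n := [ffun x : {ffun 'I_n -> 'I_q} => \sum_v pnode (x v)].

End SplitEnergy.

Section MeanValue.
Variables (R : realType) (M : penalty_model R) (r : nat).
Local Notation K := (pK M).
Local Notation q := (pq M).
Local Notation pt n := ('I_n * 'I_r)%type.
Local Notation tup n := {ffun 'I_K -> pt n}.
Local Notation nodeE := (node_energy M).

Lemma node_energy_add n1 n2 : nodeE (n1 + n2) = comb (nodeE n1) (nodeE n2).
Proof.
apply/ffunP => x; rewrite !ffunE big_split_ord /=.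
by congr (_ + _); apply: eq_bigr => v _; rewrite ffunE.
Qed.

Definition mean n (Q : seq (tup n)) : R := Val (@fst 'I_n 'I_r) (nodeE n) (fun=> true) Q.

(** An arbitrary full pattern: by [mean_full] the choice does not affect the mean. It exists when K
    divides [n * r]. *)
Definition pattern n : seq (tup n) :=
  odflt [::] (omap val [pick Q : (n * r %/ K).-tuple (tup n) |
                         perm_eq (slots Q) (enum {: pt n})]).

Definition amean n : R := mean (pattern n).

Lemma card_pt n : #|{: pt n}| = (n * r)%N.
Proof. by rewrite card_prod !card_ord. Qed.

Lemma exists_full (T : finType) : (K %| #|T|)%N ->
  exists Q : seq {ffun 'I_K -> T}, perm_eq (slots Q) (enum T).
Proof.
move=> /dvdnP[E TE]; pose c (t : T) := true.
suff H n : forall Q : seq {ffun 'I_K -> T}, uniq (slots Q) -> nf c Q true = (n * K)%N ->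
    exists Q' : seq {ffun 'I_K -> T}, perm_eq (slots Q') (enum T).
  apply: (H E [::]) => //; rewrite nf_nil -TE.
  by apply: eq_card => t; rewrite inE.
elim: n => [|n IH] Q uQ nQ.
  exists Q; apply: uniq_perm => //; first exact: enum_uniq.
  move=> t; rewrite mem_enum; apply/idP; apply: contraT => tQ.
  move/eqP: nQ; rewrite mul0n cards_eq0 => /eqP/setP/(_ t).
  by rewrite !inE tQ eqxx.
have [|e em ue] := @exists_mono R M T c Q true _ uQ; first by rewrite nQ mulSn leq_addr.
apply: (IH (e :: Q)) => //.
by have := free_cons c true ue; rewrite nQ (mono_hits _ em) mulSn /=; lia.
Qed.

Lemma mean_full n (Q : seq (tup n)) : perm_eq (slots Q) (enum {: pt n}) ->
  amean n = mean Q.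
Proof.
move=> fQ; have sQ : size Q == (n * r %/ K)%N.
  have := perm_size fQ; rewrite size_slots -cardE card_pt => <-.
  by rewrite mulnK ?pK_gt0.
have fP : perm_eq (slots (pattern n)) (enum {: pt n}).
  rewrite /pattern; case: pickP => [Q' //|/(_ (Tuple sQ))].
  by rewrite fQ.
apply: Val_colors; try by apply: full_uniq.
have cst (l : seq (pt n)) : map (fun=> true) l = nseq (size l) true by elim: l => //= _ l ->.
by rewrite !cst (perm_size fP) (perm_size fQ).
Qed.

End MeanValue.

Section Superadditivity.
Variables (R : realType) (M : penalty_model R) (r : nat).
Local Notation K := (pK M).
Local Notation pt n := ('I_n * 'I_r)%type.
Local Notation tup n := {ffun 'I_K -> pt n}.
Local Notation nodeE := (node_energy M).
Local Notation amean := (amean M r).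
Local Notation hm n := (@hmax R M 'I_n).

Lemma pattern_full n : (K %| n * r)%N ->
  perm_eq (slots (pattern M r n)) (enum {: pt n}).
Proof.
rewrite -(card_pt r) => /exists_full[Q fQ].
have sQ : size Q == (n * r %/ K)%N.
  have := perm_size fQ; rewrite size_slots -cardE card_pt => <-.
  by rewrite mulnK ?pK_gt0.
by rewrite /pattern; case: pickP => [Q' //|/(_ (Tuple sQ))]; rewrite fQ.
Qed.

Lemma colperm_true (T : finType) : colperm (fun _ : T => true) = [set: {perm T}].
Proof. by apply/setP => s; rewrite in_setT; apply/colpermP. Qed.

Lemma perm_gt0 (T : finType) : (0 < #|[set: {perm T}]|)%N.
Proof. by apply/card_gt0P; exists 1%g; rewrite inE. Qed.

Lemma amean_pattern n : (K %| n * r)%N ->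
  amean n = avg [set: {perm pt n}] (fun s =>
    EL (hm n) (img (@fst 'I_n 'I_r) s (pattern M r n)) (nodeE n)).
Proof. by move=> h; rewrite /amean /mean /Val colperm_true. Qed.

Lemma full_act (T : finType) (p : {perm T}) (Q : seq {ffun 'I_K -> T}) :
  perm_eq (slots Q) (enum T) -> perm_eq (slots (map (act p) Q)) (enum T).
Proof.
move=> fQ; rewrite slots_act; apply: uniq_perm.
- by rewrite map_inj_uniq ?full_uniq //; exact: perm_inj.
- exact: enum_uniq.
- move=> t; rewrite mem_enum; apply/mapP; exists ((p^-1)%g t); last by rewrite permKV.
  by rewrite (perm_mem fQ) mem_enum.
Qed.

(** A uniform permutation stays uniform when followed by a colour-preserving one; given the former,
    the average over the latter is the value of a shuffled full pattern. *)
Lemma amean_ge n (c : pt n -> bool) (x : R) : (K %| n * r)%N ->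
  (forall Q, perm_eq (slots Q) (enum {: pt n}) ->
     x <= Val (@fst 'I_n 'I_r) (nodeE n) c Q) -> x <= amean n.
Proof.
move=> dv xV; rewrite (amean_pattern dv).
have dbl := @avg_double R _ _ [set: {perm pt n}] (colperm c) (fun s p => p * s)%g _ (colperm_gt0 c).
rewrite dbl; [|by move=> s _; exact: mulIg|by move=> s _ p; rewrite !inE].
apply: avg_ge (perm_gt0 _) _ => p _.
apply: le_trans (xV _ (full_act p (pattern_full dv))) _.
by rewrite /Val le_eqVlt; apply/orP; left; apply/eqP/eq_avg => s _; rewrite img_act.
Qed.

Variables n1 n2 : nat.
Hypotheses (dv1 : (K %| n1 * r)%N) (dv2 : (K %| n2 * r)%N).
Let T := {: pt (n1 + n2)}.
Let c (t : pt (n1 + n2)) : bool := (t.1 < n1)%N.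
Let i1 (u : pt n1) : pt (n1 + n2) := (lshift n2 u.1, u.2).
Let i2 (u : pt n2) : pt (n1 + n2) := (rshift n1 u.1, u.2).

Let i1_inj : injective i1.
Proof.
move=> [a b] [a' b'] E; have := congr1 fst E; have /= -> := congr1 snd E.
by move=> /= /lshift_inj ->.
Qed.

Let i2_inj : injective i2.
Proof.
move=> [a b] [a' b'] E; have := congr1 fst E; have /= -> := congr1 snd E.
by move=> /= /rshift_inj ->.
Qed.

Let c_i1 u : c (i1 u) = true.
Proof. exact: (ltn_ord u.1). Qed.

Let c_i2 u : c (i2 u) = false.
Proof. by rewrite /c /= ltnNge leq_addr. Qed.

Let i1_c t : c t = true -> exists u, t = i1 u.
Proof.
case: t => v k; rewrite /c /=; case: (split_ordP v) => j -> //= _; by exists (j, k).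
Qed.

Let i2_c t : c t = false -> exists u, t = i2 u.
Proof.
case: t => v k; rewrite /c /=; case: (split_ordP v) => j -> //= _; by exists (j, k).
Qed.

Let glued : seq (tup (n1 + n2)) :=
  [seq [ffun k => i1 (e k)] | e : tup n1 <- pattern M r n1] ++
  [seq [ffun k => i2 (e k)] | e : tup n2 <- pattern M r n2].

Let slots_glued : slots glued =
  map i1 (slots (pattern M r n1)) ++ map i2 (slots (pattern M r n2)).
Proof. by rewrite /glued /slots map_cat flatten_cat -!/(slots _) !slots_map. Qed.

Let glued_full : perm_eq (slots glued) (enum T).
Proof.
rewrite slots_glued; apply: uniq_perm; last first.
- move=> t; rewrite mem_enum mem_cat; apply/orP.
  case ct : (c t); [left|right].
    have [u ->] := i1_c ct; apply: map_f.
    by rewrite (perm_mem (pattern_full dv1)) mem_enum.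
  have [u ->] := i2_c ct; apply: map_f.
  by rewrite (perm_mem (pattern_full dv2)) mem_enum.
- exact: enum_uniq.
rewrite cat_uniq !map_inj_uniq // !full_uniq ?pattern_full // andbT /=.
apply/hasPn => t /mapP[u _ ->]; apply/negP => /mapP[v _] /(congr1 c).
by rewrite c_i1 c_i2.
Qed.

(** The maximum over a disjoint union is a sum, so only the marginal laws of the two restricted
    permutations matter, and both are uniform. *)
Let Val_glued : Val (@fst 'I_(n1 + n2) 'I_r) (nodeE (n1 + n2)) c glued = amean n1 + amean n2.
Proof.
rewrite !amean_pattern // -(avg_restr i1_inj c_i1 i1_c) -(avg_restr i2_inj c_i2 i2_c) -avgD.
apply: eq_avg => s sc; rewrite node_energy_add -EL_comb; congr EL.
rewrite /img map_cat -!map_comp; congr (_ ++ _); apply: eq_map => e /=; apply/ffunP => k.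
  by rewrite !ffunE (restrP i1_inj c_i1 i1_c sc).
by rewrite !ffunE (restrP i2_inj c_i2 i2_c sc).
Qed.

Let map_nseq (A : Type) (f : A -> bool) (l : seq A) b : all (fun t => f t == b) l ->
  map f l = nseq (size l) b.
Proof. by elim: l => //= t l IH /andP[/eqP -> /IH ->]. Qed.

(** With its edges sorted by colour, [Q] has the same sequence of colours as [glued], so
    [Val_colors] applies. *)
Let local_le Q : perm_eq (slots Q) (enum T) -> all (ismono c) Q ->
  amean n1 + amean n2 <= Val (@fst 'I_(n1 + n2) 'I_r) (nodeE (n1 + n2)) c Q.
Proof.
move=> fQ aQ; set Qa := filter (mono c true) Q; set Qb := filter (predC (mono c true)) Q.
have QQ : perm_eq Q (Qa ++ Qb) by rewrite perm_sym; apply/permPl/perm_filterC.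
have all_slots (Q' : seq (tup (n1 + n2))) b : all (mono c b) Q' ->
    all (fun t => c t == b) (slots Q').
  move=> /allP h; apply/allP => t /flattenP[l /mapP[e eQ ->]] /codomP[k ->].
  by have /monoP -> := h e eQ.
have ma : all (fun t => c t == true) (slots Qa) by apply: all_slots; exact: filter_all.
have mb : all (fun t => c t == false) (slots Qb).
  apply: all_slots; apply/allP => e; rewrite mem_filter => /andP[/= ne eQ].
  by have := allP aQ e eQ; rewrite /ismono (negbTE ne).
have m1 : all (fun t => c t == true) (map i1 (slots (pattern M r n1))).
  by apply/allP => t /mapP[u _ ->]; rewrite c_i1.
have m2 : all (fun t => c t == false) (map i2 (slots (pattern M r n2))).
  by apply/allP => t /mapP[u _ ->]; rewrite c_i2.
have sab : slots (Qa ++ Qb) = slots Qa ++ slots Qb by rewrite /slots map_cat flatten_cat.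
have fab : perm_eq (slots Qa ++ slots Qb) (slots glued).
  rewrite -sab; apply: perm_trans (_ : perm_eq _ (slots Q)) _.
    by rewrite perm_sym perm_slots.
  by rewrite (perm_trans fQ) // perm_sym.
have cnt b : count (fun t => c t == b) (slots Qa ++ slots Qb) =
   count (fun t => c t == b) (slots glued) by apply/seq.permP.
have full_count b (l : seq (pt (n1 + n2))) : all (fun t => c t == b) l ->
    count (fun t => c t == b) l = size l by rewrite all_count => /eqP.
have none_count b b' (l : seq (pt (n1 + n2))) : b != b' -> all (fun t => c t == b) l ->
    count (fun t => c t == b') l = 0%N.
  move=> bb /allP h; apply/eqP; rewrite -leqn0 leqNgt -has_count; apply/hasPn => t /h /eqP ->.
  exact: bb.
have sa := cnt true; have sb := cnt false.
rewrite slots_glued !count_cat (full_count _ _ ma) (full_count _ _ m1) (none_count false true _ isT mb) (none_count false true _ isT m2) !addn0 in sa.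
rewrite slots_glued !count_cat (full_count _ _ mb) (full_count _ _ m2) (none_count true false _ isT ma) (none_count true false _ isT m1) !add0n in sb.
rewrite -Val_glued (Val_perm _ _ _ QQ) le_eqVlt; apply/orP; left; apply/eqP.
apply: Val_colors.
- exact: full_uniq glued_full.
- by rewrite -(perm_uniq (perm_slots QQ)) full_uniq.
by rewrite sab slots_glued !map_cat !(map_nseq ma) !(map_nseq mb) !(map_nseq m1) !(map_nseq m2) sa sb.
Qed.

Let card_c b : #|[set t | c t == b]| = ((if b then n1 else n2) * r)%N.
Proof.
case: b.
  rewrite -card_pt -cardsT -(card_imset _ i1_inj); apply: eq_card => t.
  rewrite inE; apply/eqP/imsetP => [/i1_c[u ->]|[u _ ->]]; last exact: c_i1.
  by exists u; rewrite ?inE.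
rewrite -card_pt -cardsT -(card_imset _ i2_inj); apply: eq_card => t.
rewrite inE; apply/eqP/imsetP => [/i2_c[u ->]|[u _ ->]]; last exact: c_i2.
by exists u; rewrite ?inE.
Qed.

Let dvdK b : (K %| #|[set t | c t == b]|)%N.
Proof. by rewrite card_c; case: b. Qed.

Let dv12 : (K %| (n1 + n2) * r)%N.
Proof. by rewrite mulnDl dvdn_add. Qed.

Let cardT : #|T| = ((n1 + n2) * r %/ K * K)%N.
Proof. by rewrite card_pt divnK. Qed.

Lemma amean_add_trivial :
  amean n1 + amean n2 - 2 * (n2 * r)%:R * lip M <= amean (n1 + n2).
Proof.
apply: (amean_ge (c := c)) => // Q fQ.
by have := full_ge_trivial local_le dvdK cardT fQ; rewrite card_c.
Qed.

Lemma amean_add (m0 : nat) : (K <= m0)%N -> (4 * m0 * K <= n1 * r)%N -> (4 * m0 * K <= n2 * r)%N ->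
  amean n1 + amean n2 - lip M * (8 * m0%:R +
    2 * ((n1 + n2) * r)%:R * K%:R ^+ 2 * (((n1 + n2) * r)%:R / m0%:R ^+ 2)
    + 4 * K%:R ^+ 2 * (((n1 + n2) * r)%:R / m0%:R)) <= amean (n1 + n2).
Proof.
move=> Km0 b1 b2; apply: (amean_ge (c := c)) => // Q fQ.
have big b : (4 * m0 * K <= #|[set t | c t == b]|)%N by rewrite card_c; case: b.
apply: le_trans (full_ge local_le dvdK cardT Km0 big fQ).
set E := ((n1 + n2) * r %/ K)%N.
have E0 : 0 <= E%:R :> R by [].
have EN : E%:R <= ((n1 + n2) * r)%:R :> R by rewrite ler_nat leq_div.
have m0i : 0 <= m0%:R^-1 :> R by rewrite invr_ge0.
have m0i2 : 0 <= (m0%:R ^+ 2)^-1 :> R by rewrite invr_ge0 exprn_ge0.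
have k2 : 0 <= K%:R ^+ 2 :> R by rewrite exprn_ge0.
rewrite lerD2l lerN2 ler_wpM2l ?lip_ge0 // !lerD //.
  apply: ler_pM; [by apply: mulr_ge0 => //; apply: mulr_ge0|exact: mulr_ge0| |exact: ler_wpM2r].
  by rewrite ler_wpM2r // ler_wpM2l.
by rewrite ler_wpM2l ?ler_wpM2r //; apply: mulr_ge0.
Qed.

End Superadditivity.

(** * Variance over permutations and labels *)

Section MeanVariance.
Variables (R : realType) (M : penalty_model R) (r : nat).
Local Notation K := (pK M).
Local Notation pt n := ('I_n * 'I_r)%type.
Local Notation tup n := {ffun 'I_K -> pt n}.
Local Notation hm n := (@hmax R M 'I_n).
Local Notation nodeE := (node_energy M).

Lemma EL_map_filter_dist (A V : finType) (f : A -> {ffun 'I_K -> V}) (p : pred A) (Q : seq A) U :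
  `|EL (@hmax R M V) (map f Q) U - EL (@hmax R M V) (map f (filter p Q)) U|
    <= (count (predC p) Q)%:R * lip M.
Proof.
have <- : EL (@hmax R M V) (map f (filter (predC p) Q) ++ map f (filter p Q)) U =
    EL (@hmax R M V) (map f Q) U.
  apply: EL_perm; rewrite -map_cat; apply: perm_map.
  by rewrite perm_catC; apply/permPl/perm_filterC.
by rewrite -size_filter -(size_map f); exact: EL_cat_dist.
Qed.

Lemma count_touch (T : finType) (x : T) (Q : seq {ffun 'I_K -> T}) : uniq (slots Q) ->
  (count (fun e : {ffun 'I_K -> T} => x \in codom e) Q <= 1)%N.
Proof.
move=> uQ; apply: (@leq_trans (count_mem x (slots Q))); last first.
  by rewrite count_uniq_mem //; case: (_ \in _).
elim: Q {uQ} => //= e Q IH; rewrite /slots /= count_cat leq_add //.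
by case: (boolP (x \in codom e)) => //; rewrite -has_pred1 has_count.
Qed.

(** At most two edges contain [x] or [y]; each of the two values is within [2 * lip M] of the value
    without them. *)
Lemma EL_tperm_dist (T V : finType) (own : T -> V) (Q : seq {ffun 'I_K -> T}) U x y s :
  uniq (slots Q) ->
  `|EL (@hmax R M V) (img own (tperm x y * s)%g Q) U - EL (@hmax R M V) (img own s Q) U|
    <= 4 * lip M.
Proof.
move=> uQ; pose p := fun e : {ffun 'I_K -> T} => (x \notin codom e) && (y \notin codom e).
have same : map (fun e : {ffun 'I_K -> T} => [ffun k => own ((tperm x y * s)%g (e k))]) (filter p Q) =
    map (fun e : {ffun 'I_K -> T} => [ffun k => own (s (e k))]) (filter p Q).
  apply/eq_in_map => e; rewrite mem_filter => /andP[/andP[xe ye] _].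
  apply/ffunP => k; rewrite !ffunE permM tpermD //.
    by apply: contraNneq xe => ->; exact: codom_f.
  by apply: contraNneq ye => ->; exact: codom_f.
have cnt : (count (predC p) Q)%:R * lip M <= 2 * lip M.
  rewrite ler_wpM2r ?lip_ge0 // ler_nat.
  apply: (@leq_trans (count (fun e : {ffun 'I_K -> T} => x \in codom e) Q +
                      count (fun e : {ffun 'I_K -> T} => y \in codom e) Q)).
    rewrite -count_predUI; apply: leq_trans (leq_addr _ _); apply: sub_count => e /=.
    by rewrite /p negb_and !negbK.
  by rewrite -[2%N]/(1 + 1)%N leq_add // count_touch.
have A := EL_map_filter_dist (fun e : {ffun 'I_K -> T} => [ffun k => own ((tperm x y * s)%g (e k))]) p Q U.
have B := EL_map_filter_dist (fun e : {ffun 'I_K -> T} => [ffun k => own (s (e k))]) p Q U.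
rewrite same in A; move: A B; rewrite /img.
set a := EL _ _ _; set b := EL _ _ _; set d := EL _ _ _.
rewrite distrC => A B; apply: le_trans (ler_distD b _ _) _; rewrite distrC in A.
by rewrite [X in _ + X]distrC; move: A B cnt; lra.
Qed.

(** Law of total variance over the permutation: the labels contribute [lip M ^+ 2] per edge, with at
    most [n * r] edges, and the permutation [(2 * (4 * lip M)) ^+ 2] per point; 65 is 1 + 64. *)
Lemma mean_variance n (Q : seq (tup n)) : perm_eq (slots Q) (enum {: pt n}) ->
  avg [set: {perm pt n}] (fun s => EL (fun W => hm n W ^+ 2) (img (@fst 'I_n 'I_r) s Q) (nodeE n))
    - amean M r n ^+ 2 <= (n * r)%:R * (65 * lip M ^+ 2).
Proof.
move=> fQ; have uQ := full_uniq fQ.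
pose f s := EL (hm n) (img (@fst 'I_n 'I_r) s Q) (nodeE n).
have -> : amean M r n = avg [set: {perm pt n}] f.
  by rewrite (mean_full fQ) /mean /Val colperm_true.
set a2 := avg _ _.
have -> : a2 - avg [set: {perm pt n}] f ^+ 2 =
   avg [set: {perm pt n}] (fun s => EL (fun W => hm n W ^+ 2) (img (@fst 'I_n 'I_r) s Q) (nodeE n)
     - f s ^+ 2) + var [set: {perm pt n}] f by rewrite /var avgB /a2; ring.
have v1 : var [set: {perm pt n}] f <= (n * r)%:R * (2 * (4 * lip M)) ^+ 2.
  by rewrite -(card_pt r); apply: var_perm => x y s; exact: EL_tperm_dist.
have v2 : avg [set: {perm pt n}] (fun s => EL (fun W => hm n W ^+ 2)
    (img (@fst 'I_n 'I_r) s Q) (nodeE n) - f s ^+ 2) <= (n * r)%:R * lip M ^+ 2.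
  apply: avg_le_const (perm_gt0 _) _ => s _; apply: le_trans (EL_var _ _) _.
  rewrite ler_wpM2r ?exprn_ge0 ?lip_ge0 // ler_nat size_map.
  rewrite -(card_pt r) cardE -(perm_size fQ) size_slots.
  by rewrite -{1}[size Q]muln1 leq_mul2l pK_gt0 orbT.
by apply: le_trans (lerD v2 v1) _; rewrite -mulrDr le_eqVlt; apply/orP; left; apply/eqP; ring.
Qed.

Definition node_bound : R := \sum_(i : 'I_(pq M)) `|pnode i|.

Lemma hmax_node_le n : `|hm n (nodeE n)| <= n%:R * node_bound.
Proof.
have [x ->] := hmax_attained (nodeE n); rewrite ffunE.
apply: le_trans (ler_norm_sum _ _ _) _.
rewrite -[n in n%:R]card_ord mulr_natl -sumr_const; apply: ler_sum => v _.
by rewrite /node_bound (bigD1 (x v)) //= lerDl sumr_ge0.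
Qed.

Lemma amean_le n : (K %| n * r)%N -> `|amean M r n| <= n%:R * (node_bound + r%:R * lip M).
Proof.
move=> dv; rewrite (amean_pattern dv).
rewrite -[X in `|X|]subr0 -[X in _ - X](avg_const 0 (perm_gt0 {: pt n})).
apply: avg_dist (perm_gt0 _) _ => s _; rewrite subr0.
have := EL_cat_dist (img (@fst 'I_n 'I_r) s (pattern M r n)) [::] (nodeE n).
rewrite cats0 /= size_map => h.
rewrite -[X in `|X|](subrK (hm n (nodeE n))); apply: le_trans (ler_normD _ _) _.
rewrite mulrDr addrC lerD ?hmax_node_le // (le_trans h) // mulrA -natrM.
rewrite ler_wpM2r ?lip_ge0 // ler_nat -(card_pt r) cardE -(perm_size (pattern_full dv)) size_slots.
by rewrite -{1}[size _]muln1 leq_mul2l pK_gt0 orbT.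
Qed.

End MeanVariance.

(** * The configuration model *)

Section ExtendedModel.
Variable R : realType.

Definition model_of (M : penalty_model R) : model R :=
  @Model R (pK M) (pq M) (pL M) (fun i => (pnode i)%:E)
    (fun a s => (pbase M - ppen M * (pbad a s)%:R)%:E).

Variables (M : penalty_model R) (n r : nat).
Local Notation K := (pK M).
Local Notation q := (pq M).
Local Notation L := (pL M).
Local Notation pt := ('I_n * 'I_r)%type.
Local Notation nodeE := (node_energy M n).
Variable t0 : pt.

Definition block_tuple (B : {set pt}) : {ffun 'I_K -> pt} := [ffun k : 'I_K => nth t0 (enum B) k].
Definition block_edge (B : {set pt}) : {ffun 'I_K -> 'I_n} := [ffun k => (block_tuple B k).1].
Definition configs : {set {set {set pt}}} := [set P | config_ok (model_of M) P].
Definition Hreal (w : sample (model_of M) n r) : R :=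
  hmax (nodeE + \sum_(B <- enum w.1) edge (w.2 B) (block_edge B)).

Lemma codom_block (B : {set pt}) : #|B| = K -> codom (block_tuple B) = enum B.
Proof.
move=> BK; have sz : size (enum B) = K by rewrite -cardE.
apply: (@eq_from_nth _ t0) => [|k]; rewrite size_codomK ?sz // => kK.
rewrite (nth_map (Ordinal kK)) ?size_enum_ord // ffunE.
by congr (nth _ _ _); rewrite nth_enum_ord.
Qed.

Lemma configsP (P : {set {set pt}}) : P \in configs ->
  partition P setT /\ (forall B : {set pt}, B \in P -> #|B| = K).
Proof.
rewrite inE => /andP[pP /forallP h]; split=> // B BP.
by apply/eqP; have /implyP := h B; apply.
Qed.

Lemma HG_model_of (w : sample (model_of M) n r) : w.1 \in configs -> HG w = (Hreal w)%:E.
Proof.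
move=> /configsP[_ wK].
have Hxw x : @Hx R (model_of M) n r w x =
    ((nodeE + \sum_(B <- enum w.1) edge (w.2 B) (block_edge B)) x)%:E.
  rewrite /Hx [\sum_(i < n) _]sumEFin [X in (_ + X)%E]sumEFin -EFinD; congr EFin.
  rewrite !ffunE; congr (_ + _).
  rewrite [RHS]sum_ffunE -big_enum /=; apply: eq_big_seq => B; rewrite mem_enum => BP.
  rewrite ffunE; congr (_ - _ * (nat_of_bool (pbad _ _))%:R).
  rewrite /spins /hyperedge -(codom_block (wK _ BP)) -!map_comp.
  by apply: eq_map => k; rewrite /= !ffunE.
rewrite /HG (eq_bigr _ (fun x _ => Hxw x)).
rewrite /Hreal; set U := nodeE + _; apply/eqP; rewrite eq_le; apply/andP; split.
  apply/bigmax_leP; split=> [|x _]; first exact: leNye.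
  by rewrite lee_fin; exact: hmax_ge.
have [x ->] := hmax_attained U.
exact: (le_bigmax -oo%E (fun y => (U y)%:E) x).
Qed.

(** Labels are drawn for all indices at once, whereas [EL] draws them edge by edge; resampling a
    single label preserves the uniform law and allows an induction on [s]. *)
Lemma avg_labels (I V : finType) g (f : I -> {ffun 'I_K -> V}) (s : seq I)
    (U : {ffun {ffun V -> 'I_q} -> R}) : uniq s ->
  avg [set: {ffun I -> L}] (fun lab : {ffun I -> L} => g (U + \sum_(i <- s) edge (lab i) (f i)))
  = EL g (map f s) U.
Proof.
have lab0 : (0 < #|[set: {ffun I -> L}]|)%N.
  by apply/card_gt0P; exists [ffun=> plab M]; rewrite inE.
elim: s U => [|i s IH] U /=.
  by move=> _; under eq_avg => lab _ do rewrite big_nil addr0; rewrite avg_const.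
move=> /andP[is_ us].
pose upd (lab : {ffun I -> L}) a : {ffun I -> L} := [ffun j => if j == i then a else lab j].
have resample (F : {ffun I -> L} -> R) :
    avg [set: {ffun I -> L}] F = avg [set: {ffun I -> L}] (fun lab => avg [set: L] (fun a => F (upd lab a))).
  have L0 : #|[set: L]|%:R != 0 :> R by rewrite pnatr_eq0 -lt0n label_gt0.
  rewrite /avg; congr (_ / _); rewrite -mulr_suml; apply: (mulIf L0); rewrite divfK //.
  have sT (J : finType) (G : J -> R) : \sum_(j in [set: J]) G j = \sum_j G j.
    by apply: eq_bigl => j; rewrite inE.
  rewrite !sT (eq_bigr _ (fun lab _ => sT _ _)) pair_big /=.
  (* The change of variables exchanges the label of [i] with its independent copy. *)
  rewrite (reindex_inj (h := fun z : {ffun I -> L} * L => (upd z.1 z.2, z.1 i))) /=.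
    rewrite (eq_bigr (fun z : {ffun I -> L} * L => F z.1)); last first.
      move=> [lab a] _ /=; congr F; apply/ffunP => j; rewrite !ffunE.
      by case: eqP => [->|].
    rewrite -(pair_big xpredT xpredT (fun lab (_ : L) => F lab)) /=.
    by rewrite mulr_suml; apply: eq_bigr => lab _; rewrite sumr_const cardsT mulr_natr.
  move=> [lab a] [lab' a'] /= [E1 E2]; congr pair; last first.
    by have := congr1 (fun z : {ffun I -> L} => z i) E1; rewrite !ffunE eqxx.
  apply/ffunP => j; have [->|ji] := eqVneq j i; first exact: E2.
  by have := congr1 (fun z : {ffun I -> L} => z j) E1; rewrite !ffunE (negbTE ji).
rewrite resample avg_exchange; apply: eq_avg => a _.
rewrite -IH //; apply: eq_avg => lab _; congr g.
rewrite big_cons addrA ffunE eqxx; congr (_ + _); apply: eq_big_seq => j js.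
by rewrite ffunE; case: eqP => // ji; rewrite -ji js in is_.
Qed.

Lemma avg_setX (I J : finType) (A : {set I}) (B : {set J}) (F : I * J -> R) :
  avg (setX A B) F = avg A (fun i => avg B (fun j => F (i, j))).
Proof.
rewrite /avg cardsX natrM invfM mulrA -mulr_suml pair_big_dep /= mulrAC; congr (_ / _ / _).
by apply: eq_big => [z|z _]; [by case: z => i j; rewrite in_setX | by case: z].
Qed.

Lemma avg_Omega (g : R -> R) :
  avg (Omega (model_of M) n r) (fun w => g (Hreal w)) =
  avg configs (fun P => EL (g \o @hmax R M _) (map block_edge (enum P)) nodeE).
Proof.
have -> : Omega (model_of M) n r = setX configs [set: {ffun {set pt} -> L}].
  by apply/setP => -[P lab]; rewrite in_setX !inE andbT.
rewrite avg_setX; apply: eq_avg => P _.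
by rewrite -(avg_labels _ _ _ (enum_uniq _)).
Qed.

Lemma config_full P : P \in configs -> perm_eq (slots (map block_tuple (enum P))) (enum {: pt}).
Proof.
move=> /configsP[pP PK]; apply/seq.permP => a.
have cnt (B : {set pt}) : count a (enum B) = (\sum_(t in B) a t)%N.
  rewrite -sum1_count big_enum_cond /= big_mkcondr /=; apply: eq_bigr => t _.
  by case: (a t).
have -> : count a (enum {: pt}) = (\sum_(t in [set: pt]) a t)%N.
  by rewrite -cnt; congr count; apply: eq_enum => t; rewrite in_setT.
rewrite (set_partition_big _ pP) /slots count_flatten sumnE !big_map big_enum /=.
by apply: eq_bigr => B BP; rewrite codom_block ?PK // cnt.
Qed.

Definition act_config (s : {perm pt}) (P : {set {set pt}}) : {set {set pt}} :=
  [set [set s t | t in B : {set pt}] | B in P].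

Lemma act_config_inj s : injective (act_config s).
Proof. by apply: imset_inj; apply: imset_inj; exact: perm_inj. Qed.

Lemma act_config_ok s P : (act_config s P \in configs) = (P \in configs).
Proof.
have sT : [set s t | t in [set: pt]] = [set: pt].
  by apply/setP => t; rewrite inE; apply/imsetP; exists ((s^-1)%g t); rewrite ?inE ?permKV.
rewrite !inE /config_ok -{1}sT imset_partition; last exact: perm_inj.
congr (_ && _); apply/forallP/forallP => h B; apply/implyP => BP.
  have /implyP/(_ (imset_f _ BP)) := h [set s t | t in B].
  by rewrite card_imset //; exact: perm_inj.
case/imsetP: BP => B' B'P ->; rewrite card_imset; last exact: perm_inj.
by have /implyP := h B'; apply.
Qed.

(** The image of a block is listed in the canonical order of its own points, so it agrees with the
    permuted tuple only up to reordering; [EL_map_codom] removes the difference. *)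
Lemma EL_act_config g s P : P \in configs ->
  EL g (map block_edge (enum (act_config s P))) nodeE =
  EL (M := M) g (img (@fst 'I_n 'I_r) s (map block_tuple (enum P))) nodeE.
Proof.
move=> /configsP[_ PK].
have s_inj : injective (fun B : {set pt} => [set s t | t in B]).
  by apply: imset_inj; exact: perm_inj.
have pe (A B : finType) (h : A -> B) (C : {set A}) : injective h ->
    perm_eq (enum [set h x | x in C]) (map h (enum C)).
  move=> hI; apply: uniq_perm; rewrite ?enum_uniq ?map_inj_uniq ?enum_uniq // => y.
  rewrite mem_enum; apply/imsetP/mapP => -[x xC ->]; exists x => //; by rewrite mem_enum in xC *.
rewrite (EL_perm _ _ (perm_map _ (pe _ _ _ _ s_inj))) /img -!map_comp.
apply: EL_map_codom => B; rewrite mem_enum => BP /=.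
have cb : perm_eq (codom (block_tuple [set s t | t in B])) (map s (codom (block_tuple B))).
  have sB : #|[set s t | t in B]| = K by rewrite card_imset ?PK //; exact: perm_inj.
  rewrite (codom_block sB) (codom_block (PK _ BP)).
  by apply: pe; exact: perm_inj.
have cbe (B' : {set pt}) : codom (block_edge B') = map fst (codom (block_tuple B')).
  by rewrite /codom /image_mem -map_comp; apply: eq_map => k /=; rewrite ffunE.
rewrite cbe; apply: perm_trans (perm_map fst cb) _.
rewrite (_ : map fst _ = codom [ffun k => (s (block_tuple B k)).1]) //.
by rewrite /codom /image_mem -!map_comp; apply: eq_map => k /=; rewrite !ffunE.
Qed.

Lemma avg_Omega_perm (g : R -> R) :
  avg (Omega (model_of M) n r) (fun w => g (Hreal w)) =
  avg configs (fun P => avg [set: {perm pt}] (fun s =>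
    EL (g \o @hmax R M _) (img (@fst 'I_n 'I_r) s (map block_tuple (enum P))) nodeE)).
Proof.
rewrite avg_Omega.
rewrite (@avg_double _ _ _ configs [set: {perm pt}] act_config _ (perm_gt0 _)).
- by apply: eq_avg => P Pc; apply: eq_avg => s _; exact: EL_act_config.
- by move=> s _; exact: act_config_inj.
- by move=> s _ P; exact: act_config_ok.
Qed.

Lemma EL_sq_dev (V : finType) (Q : seq {ffun 'I_K -> V}) U (m : R) :
  EL ((fun y => (y - m) ^+ 2) \o @hmax R M V) Q U =
  EL (fun W => hmax W ^+ 2) Q U + ((- (2 * m)) * EL (@hmax R M V) Q U + m ^+ 2).
Proof.
elim: Q U => [|e Q IH] U /=; first by ring.
rewrite (eq_avg (fun a _ => IH (U + edge a e))).
by rewrite avgD avgD avgZ avg_const ?label_gt0.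
Qed.

(** Given [P], the maximum after a uniform shuffle has mean [amean M r n] whatever [P] is, so the
    variation between configurations adds nothing. *)
Lemma Omega_variance : (0 < #|configs|)%N ->
  avg (Omega (model_of M) n r) (fun w => (Hreal w - amean M r n) ^+ 2)
    <= (n * r)%:R * (65 * lip M ^+ 2).
Proof.
move=> c0; rewrite (avg_Omega_perm (fun y => (y - amean M r n) ^+ 2)).
apply: avg_le_const => // P Pc; have fP := config_full Pc.
apply: le_trans (mean_variance fP).
under eq_avg => s _ do rewrite EL_sq_dev.
rewrite avgD avgD avgZ (avg_const _ (perm_gt0 _)).
have -> : avg [set: {perm pt}] (fun s => EL (@hmax R M _)
   (img (@fst 'I_n 'I_r) s (map block_tuple (enum P))) nodeE) = amean M r n.
  by rewrite (mean_full fP) /mean /Val colperm_true.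
rewrite le_eqVlt; apply/orP; left; apply/eqP; ring.
Qed.

Lemma chebyshev_avg (I : finType) (A : {set I}) (f : I -> R) (eps : R) : 0 < eps ->
  #|[set w in A | eps < `|f w|]|%:R / #|A|%:R <= avg A (fun w => f w ^+ 2) / eps ^+ 2.
Proof.
move=> e0; rewrite /avg mulrAC ler_wpM2r ?invr_ge0 // ler_pdivlMr ?exprn_gt0 //.
rewrite mulr_natl -sumr_const [X in _ <= X](bigID (fun w => eps < `|f w|)) /=.
rewrite (eq_bigl (fun w => (w \in A) && (eps < `|f w|))); last by move=> w; rewrite inE.
rewrite -[X in X <= _]addr0 lerD //; last by apply: sumr_ge0 => w _; exact: sqr_ge0.
apply: ler_sum => w /andP[_ we].
by rewrite -[f w ^+ 2]real_normK ?num_real // lerXn2r ?nnegrE // ltW.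
Qed.

Lemma prob_dev_le (h eps : R) : 0 < eps -> (0 < n)%N ->
  prob_dev (model_of M) n r h eps <=
  (2 * r%:R * (65 * lip M ^+ 2) / n%:R + 2 * (amean M r n / n%:R - h) ^+ 2) / eps ^+ 2.
Proof.
move=> e0 n0; set Om := Omega (model_of M) n r.
have n0R : 0 < n%:R :> R by rewrite ltr0n.
have l2 : 0 <= lip M ^+ 2 by rewrite exprn_ge0 ?lip_ge0.
have rhs0 : 0 <= 2 * r%:R * (65 * lip M ^+ 2) / n%:R + 2 * (amean M r n / n%:R - h) ^+ 2.
  apply: addr_ge0; first by apply: divr_ge0; [apply: mulr_ge0; apply: mulr_ge0|].
  by apply: mulr_ge0 => //; exact: sqr_ge0.
have -> : prob_dev (model_of M) n r h eps =
    #|[set w in Om | eps < `|Hreal w / n%:R - h|]|%:R / #|Om|%:R.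
  rewrite /prob_dev; congr (_%:R / _); apply: eq_card => w; rewrite !inE.
  apply: andb_id2l => w_ok; rewrite HG_model_of ?inE //.
apply: le_trans (chebyshev_avg _ _ e0) _.
rewrite ler_wpM2r ?invr_ge0 ?exprn_ge0 ?(ltW e0) //.
have [Om0|Om0] := posnP #|Om|.
  by rewrite /avg Om0 invr0 mulr0.
have c0 : (0 < #|configs|)%N.
  by have /card_gt0P[w] := Om0; rewrite inE => wc; apply/card_gt0P; exists w.1; rewrite inE.
pose m := amean M r n.
apply: (@le_trans _ _ (avg Om (fun w => 2 / n%:R ^+ 2 * (Hreal w - m) ^+ 2 + 2 * (m / n%:R - h) ^+ 2))).
  apply: avg_le => w _.
  have -> : 2 / n%:R ^+ 2 * (Hreal w - m) ^+ 2 = 2 * ((Hreal w / n%:R - h) - (m / n%:R - h)) ^+ 2.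
    by field; rewrite lt0r_neq0.
  set x := Hreal w / n%:R - h; set y := m / n%:R - h.
  (* This is [x ^+ 2 <= 2 * (x - y) ^+ 2 + 2 * y ^+ 2], separating the fluctuation from the bias
     [y]. *)
  rewrite -subr_ge0 (_ : _ - _ = (x - 2 * y) ^+ 2) ?sqr_ge0 //; ring.
rewrite avgD avg_const // lerD2r avgZ.
have -> : 2 * r%:R * (65 * lip M ^+ 2) / n%:R =
   2 / n%:R ^+ 2 * ((n * r)%:R * (65 * lip M ^+ 2)) :> R.
  by rewrite natrM; field; rewrite lt0r_neq0.
by apply: ler_wpM2l; [rewrite divr_ge0 ?exprn_ge0 | exact: Omega_variance].
Qed.

End ExtendedModel.

(** * Limits of nearly superadditive sequences *)

Section NearSuperadditive.
Variable R : realType.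

Definition qrt (n : nat) : R := Num.sqrt (Num.sqrt n%:R).

Lemma qrt_ge0 n : 0 <= qrt n. Proof. exact: sqrtr_ge0. Qed.

Lemma qrt4 n : qrt n ^+ 4 = n%:R.
Proof. by rewrite -[4%N]/(2 * 2)%N exprM /qrt !sqr_sqrtr ?sqrtr_ge0. Qed.

Lemma qrt_gt0 n : (0 < n)%N -> 0 < qrt n.
Proof. by move=> n0; rewrite /qrt !sqrtr_gt0 ltr0n. Qed.

Lemma le_qrt (x : R) n : 0 <= x -> x ^+ 4 <= n%:R -> x <= qrt n.
Proof. by move=> x0 xn; rewrite -(@ler_pXn2r _ 4) ?nnegrE ?qrt_ge0 // qrt4. Qed.

(* 0.91^4 > 2/3, so each part of a balanced splitting has qrt at most 0.91 of the total. *)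
Lemma qrt_balanced n1 n2 : (0 < n1)%N -> (n1 <= 2 * n2)%N -> (n2 <= 2 * n1)%N ->
  13 / 12 * qrt (n1 + n2) ^+ 3 <= qrt n1 ^+ 3 + qrt n2 ^+ 3.
Proof.
move=> n10 h1 h2; set u := qrt (n1 + n2); set u1 := qrt n1; set u2 := qrt n2.
have u0 : 0 < u by rewrite qrt_gt0 // addn_gt0 n10.
have part k : (3 * k <= 2 * (n1 + n2))%N -> qrt k <= 91 / 100 * u.
  move=> hk; rewrite -(@ler_pXn2r _ 4) ?nnegrE ?qrt_ge0 //; last by rewrite mulr_ge0 ?ltW ?divr_gt0.
  rewrite exprMn /u !qrt4.
  have : (3 * k)%:R <= (2 * (n1 + n2))%:R :> R by rewrite ler_nat.
  rewrite !natrM; have : 0 <= (n1 + n2)%:R :> R by [].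
  lra.
have p1 : u1 <= 91 / 100 * u by apply: part; lia.
have p2 : u2 <= 91 / 100 * u by apply: part; lia.
have c1 : 0 <= u1 ^+ 3 by rewrite exprn_ge0 ?qrt_ge0.
have c2 : 0 <= u2 ^+ 3 by rewrite exprn_ge0 ?qrt_ge0.
have E : u1 ^+ 4 + u2 ^+ 4 = u ^+ 4 by rewrite !qrt4 natrD.
have q1 : u1 ^+ 4 <= u1 ^+ 3 * (91 / 100 * u) by rewrite exprSr ler_wpM2l.
have q2 : u2 ^+ 4 <= u2 ^+ 3 * (91 / 100 * u) by rewrite exprSr ler_wpM2l.
have q : u ^+ 3 <= 91 / 100 * (u1 ^+ 3 + u2 ^+ 3).
  rewrite -(ler_pM2r u0) -exprSr -E.
  have -> : 91 / 100 * (u1 ^+ 3 + u2 ^+ 3) * u = u1 ^+ 3 * (91 / 100 * u) + u2 ^+ 3 * (91 / 100 * u) by ring.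
  exact: lerD.
have u3 : 0 <= u ^+ 3 by rewrite exprn_ge0 // ltW.
(* Here [100 / 91 > 13 / 12]. *)
lra.
Qed.

Variables (P : nat -> bool) (a : nat -> R) (A B C : R).
Hypothesis P_add : forall m n, P m -> P n -> P (m + n).
Hypothesis P_sub : forall m n, P m -> P (m + n) -> P n.
Hypothesis a_le : forall n, P n -> `|a n| <= A * n%:R.
Hypothesis a_add : forall m n, P m -> P n -> a m + a n - B * n%:R <= a (m + n).
Hypothesis C0 : 0 <= C.
Hypothesis a_balanced : forall m n, (0 < m)%N -> (0 < n)%N -> P m -> P n ->
  (m <= 2 * n)%N -> (n <= 2 * m)%N ->
  a m + a n - C * qrt (m + n) ^+ 3 <= a (m + n).

(** By [qrt_balanced] the correction gains at least [12 * C / 12 = C] times [qrt (m + n) ^+ 3] in a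
    balanced addition, which absorbs the error of [a_balanced]. *)
Let b n : R := a n - 12 * C * qrt n ^+ 3.

Lemma b_balanced m n : (0 < m)%N -> (0 < n)%N -> P m -> P n ->
  (m <= 2 * n)%N -> (n <= 2 * m)%N -> b m + b n <= b (m + n).
Proof.
move=> m0 n0 Pm Pn h1 h2; have := a_balanced m0 n0 Pm Pn h1 h2.
have := qrt_balanced m0 h1 h2; rewrite -subr_ge0 => h.
have : 0 <= 12 * C * (qrt m ^+ 3 + qrt n ^+ 3 - 13 / 12 * qrt (m + n) ^+ 3).
  by apply: mulr_ge0 => //; apply: mulr_ge0.
by rewrite /b; lra.
Qed.

Lemma P_mul q m : P m -> (0 < q)%N -> P (q * m).
Proof.
move=> Pm; elim: q => // -[|q] IH _; first by rewrite mul1n.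
by rewrite mulSn; apply: P_add => //; exact: IH.
Qed.

(** Repeated halving of [q]: the two halves differ by at most 1 and so stay within a factor 2 of
    each other, as [b_balanced] demands. *)
Lemma b_mul q m : (0 < m)%N -> P m -> (0 < q)%N -> q%:R * b m <= b (q * m).
Proof.
move=> m0 Pm; have [k qk] := ubnP q; elim: k q qk => // k IH q qk q0.
have [q1|q1] := leqP q 1.
  by have -> : q = 1%N by [lia]; rewrite mul1r mul1n.
pose x := q./2; pose y := (q - x)%N.
have qxy : q = (x + y)%N by rewrite /y /x; lia.
have x0 : (0 < x)%N by rewrite /x; lia.
have y0 : (0 < y)%N by rewrite /y /x; lia.
have xk : (x < k)%N by rewrite /x; lia.
have yk : (y < k)%N by rewrite /y /x; lia.
have Hx := IH x xk x0; have Hy := IH y yk y0.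
have xy : (x <= 2 * y)%N by rewrite /y /x; lia.
have yx : (y <= 2 * x)%N by rewrite /y /x; lia.
have H : b (x * m) + b (y * m) <= b (x * m + y * m).
  by apply: b_balanced; rewrite ?muln_gt0 ?x0 ?y0 ?m0 ?P_mul ?mulnA ?leq_pmul2r.
rewrite -mulnDl -qxy in H; rewrite {1}qxy natrD mulrDl.
by apply: le_trans H; exact: lerD.
Qed.

(** Euclidean division of [n] by [m]: the multiple is handled by [b_mul], and the remainder,
    admissible by [P_sub], costs an amount bounded in terms of [m]. *)
Lemma a_lower n m : (0 < m)%N -> P m -> P n -> (m <= n)%N ->
  b m / m%:R - (`|b m| + (`|A| + `|B|) * m%:R) / n%:R <= a n / n%:R.
Proof.
move=> m0 Pm Pn mn; set q := (n %/ m)%N; set rho := (n %% m)%N.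
have m0R : 0 < m%:R :> R by rewrite ltr0n.
have n0R : 0 < n%:R :> R by rewrite ltr0n (leq_trans m0).
have q0 : (0 < q)%N by rewrite divn_gt0.
have nE : n = (q * m + rho)%N by rewrite -divn_eq.
have Pq := P_mul Pm q0.
have Pr : P rho by apply: (P_sub Pq); rewrite -nE.
have rm : rho%:R <= m%:R :> R by rewrite ler_nat ltnW // ltn_pmod.
have r0 : 0 <= rho%:R :> R by [].
have h1 := a_add Pq Pr; rewrite -nE in h1.
have h2 := b_mul m0 Pm q0.
have h3 := a_le Pr.
have h4 : b (q * m) <= a (q * m).
  by rewrite /b lerBlDr lerDl mulr_ge0 ?mulr_ge0 ?exprn_ge0 ?qrt_ge0.
have h5 : A * rho%:R <= `|A| * m%:R.
  by apply: (@le_trans _ _ (`|A| * rho%:R)); [rewrite ler_wpM2r ?ler_norm | rewrite ler_wpM2l].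
have h6 : B * rho%:R <= `|B| * m%:R.
  by apply: (@le_trans _ _ (`|B| * rho%:R)); [rewrite ler_wpM2r ?ler_norm | rewrite ler_wpM2l].
have h7 : - (`|A| * m%:R) <= a rho.
  by have := ler_norm (- a rho); rewrite normrN; lra.
have h8 : b m / m%:R * rho%:R <= `|b m|.
  apply: (@le_trans _ _ (`|b m| / m%:R * rho%:R)).
    by apply: ler_wpM2r => //; apply: ler_wpM2r; [rewrite invr_ge0 ltW | exact: ler_norm].
  by rewrite mulrAC ler_pdivrMr // ler_wpM2l.
have qm : q%:R * b m = b m / m%:R * n%:R - b m / m%:R * rho%:R.
  rewrite {1}nE natrD natrM; field; exact: lt0r_neq0.
rewrite ler_pdivlMr // mulrBl divfK ?lt0r_neq0 //; lra.
Qed.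

(** As in Fekete's lemma, the limit is the supremum of [b m / m]; the upper bound holds because [a]
    and [b] differ by o(n). *)
Lemma near_superadditive_limit m1 : (0 < m1)%N -> P m1 ->
  exists h : R, forall eta, 0 < eta -> exists n0 : nat, forall n, (n0 <= n)%N -> P n ->
    `|a n / n%:R - h| <= eta.
Proof.
move=> m10 Pm1.
pose S : classical_sets.set R := fun y => exists m, [/\ (0 < m)%N, P m & y = b m / m%:R].
have b_ub m : (0 < m)%N -> P m -> b m / m%:R <= A.
  move=> m0 Pm; rewrite ler_pdivrMr ?ltr0n //.
  have := le_trans (ler_norm _) (a_le Pm).
  have : 0 <= 12 * C * qrt m ^+ 3 by rewrite mulr_ge0 ?mulr_ge0 ?exprn_ge0 ?qrt_ge0.
  by rewrite /b; lra.
have S_sup : classical_sets.has_sup S.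
  split; first by exists (b m1 / m1%:R), m1.
  by exists A => y [m [m0 Pm ->]]; exact: b_ub.
exists (sup S) => eta eta0.
have eta2 : 0 < eta / 2 by rewrite divr_gt0.
have [y [m [m0 Pm ->]] ym] := sup_adherent eta2 S_sup.
pose w1 := `|b m| + (`|A| + `|B|) * m%:R.
(* Once [n >= w2 ^+ 4], [qrt n >= w2], and the correction divided by [n], that is [12 * C / qrt n],
   is at most [eta]. *)
pose w2 := 12 * C / eta.
have w10 : 0 <= w1 by rewrite addr_ge0 // mulr_ge0 // addr_ge0.
have w20 : 0 <= w2 by apply: divr_ge0; [exact: mulr_ge0 | exact: ltW].
pose x1 := w1 / (eta / 2).
have x10 : 0 <= x1 by rewrite divr_ge0 // ltW.
have x20 : 0 <= w2 ^+ 4 by rewrite exprn_ge0.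
exists (maxn m (maxn (Num.bound x1) (Num.bound (w2 ^+ 4)))) => n.
rewrite !geq_max => /and3P[mn n1 n2] Pn.
have n0 : (0 < n)%N := leq_trans m0 mn.
have n0R : 0 < n%:R :> R by rewrite ltr0n.
have n1R : x1 <= n%:R.
  by apply: le_trans (ltW (archi_boundP x10)) _; rewrite ler_nat.
have n2R : w2 ^+ 4 <= n%:R.
  by apply: le_trans (ltW (archi_boundP x20)) _; rewrite ler_nat.
have low := a_lower m0 Pm Pn mn; rewrite -/w1 in low.
have e1 : w1 / n%:R <= eta / 2.
  by rewrite ler_pdivrMr // mulrC -ler_pdivrMr.
have up : b n / n%:R <= sup S by apply: ub_le_sup; [case: S_sup | exists n].
have u0 := qrt_gt0 n0.
have e2 : 12 * C * qrt n ^+ 3 / n%:R <= eta.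
  have := le_qrt w20 n2R; rewrite /w2 ler_pdivrMr // => h.
  rewrite -(qrt4 n) ler_pdivrMr ?exprn_gt0 //
    (_ : eta * qrt n ^+ 4 = eta * qrt n * qrt n ^+ 3); last by ring.
  apply: ler_wpM2r.
    by rewrite exprn_ge0 // qrt_ge0.
  by rewrite [eta * _]mulrC.
have bn : a n / n%:R = b n / n%:R + 12 * C * qrt n ^+ 3 / n%:R.
  by rewrite /b mulrBl subrK.
rewrite ler_distl; apply/andP; split; lra.
Qed.

End NearSuperadditive.

Section Convergence.
Variables (R : realType) (M : penalty_model R) (r : nat).
Hypothesis r0 : (0 < r)%N.
Local Notation K := (pK M).
Local Notation amean := (amean M r).

Lemma exists_root4 n : (0 < n)%N -> exists2 s, (0 < s)%N & (s ^ 4 <= n < 16 * s ^ 4)%N.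
Proof.
move=> n0; have ex : exists s, (s ^ 4 <= n)%N by exists 1%N.
have ub s : (s ^ 4 <= n)%N -> (s <= n)%N.
  by apply: leq_trans; case: s => // s; rewrite -{1}[s.+1]expn1 leq_pexp2l.
have [s sn smax] := ex_maxnP ex ub.
have s0 : (0 < s)%N by apply: smax; rewrite exp1n.
exists s => //; rewrite sn /= ltnNge; apply/negP => big.
have := smax (2 * s)%N; rewrite expnMn => /(_ big); lia.
Qed.

(** Coefficients for [m0 = s ^ 3] and N at most [16 * s ^ 4]: 8 comes from [8 * m0], 512 is
    [2 * 16 ^ 2], 64 is [4 * 16], and 384 is [2 * 16 * 12], for the case [s < 12 * K]. *)
Definition split_cost : R :=
  lip M * (8 + 512 * r%:R ^+ 2 * K%:R ^+ 2 + 64 * K%:R ^+ 2 * r%:R + 384 * K%:R * r%:R).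

Lemma amean_balanced m n : (0 < m)%N -> (0 < n)%N -> (K %| m * r)%N -> (K %| n * r)%N ->
  (m <= 2 * n)%N -> (n <= 2 * m)%N ->
  amean m + amean n - split_cost * qrt R (m + n) ^+ 3 <= amean (m + n).
Proof.
move=> m0 n0 dm dn h1 h2.
have [|s s0 /andP[s1 s2]] := @exists_root4 (m + n); first by rewrite addn_gt0 m0.
have l0 := lip_ge0 M.
have s0R : 1 <= s%:R :> R by rewrite ler1n.
have r0R : 0 <= r%:R :> R by [].
have K0R : 0 <= K%:R :> R by [].
have K2 : 0 <= K%:R ^+ 2 :> R by rewrite exprn_ge0.
have cost0 : 0 <= split_cost.
  apply: mulr_ge0 => //; rewrite !addr_ge0 //; try (by rewrite !mulr_ge0 // exprn_ge0).
have su : s%:R ^+ 3 <= qrt R (m + n) ^+ 3.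
  rewrite lerXn2r ?nnegrE ?qrt_ge0 //; apply: le_qrt => //.
  by rewrite -natrX ler_nat.
apply: (@le_trans _ _ (amean m + amean n - split_cost * s%:R ^+ 3)).
  by rewrite lerD2l lerN2 ler_wpM2l.
have N16 : (m + n)%:R <= 16 * s%:R ^+ 4 :> R.
  by rewrite -natrX -natrM ler_nat ltnW.
have s3 : 0 <= s%:R ^+ 3 :> R by rewrite exprn_ge0.
(* Both parts have at least [s ^ 4 / 3] nodes, so [4 * s ^ 3 * K] points are available in each as
   soon as [s >= 12 * K]; for smaller [s] the trivial bound suffices. *)
have [small|large] := ltnP s (12 * K).
  apply: le_trans (amean_add_trivial dm dn).
  rewrite lerD2l lerN2.
  have sK : s%:R <= 12 * K%:R :> R by rewrite -natrM ler_nat ltnW.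
  apply: (@le_trans _ _ (lip M * (384 * K%:R * r%:R) * s%:R ^+ 3)); last first.
    rewrite ler_wpM2r // ler_wpM2l // lerDr !addr_ge0 //.
      by rewrite !mulr_ge0 // exprn_ge0.
    by rewrite !mulr_ge0.
  have -> : 2 * (n * r)%:R * lip M = 2 * r%:R * lip M * n%:R by rewrite natrM; ring.
  have -> : lip M * (384 * K%:R * r%:R) * s%:R ^+ 3 =
     2 * r%:R * lip M * (16 * (12 * K%:R * s%:R ^+ 3)) by ring.
  rewrite ler_wpM2l ?mulr_ge0 //.
  apply: (@le_trans _ _ (m + n)%:R); first by rewrite ler_nat leq_addl.
  by apply: le_trans N16 _; rewrite ler_wpM2l // exprS ler_wpM2r.
have kp := pK_gt0 M.
have s4 : (s ^ 4 = s * s ^ 3)%N by rewrite expnS.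
have big k : (s ^ 4 <= 3 * k)%N -> (4 * s ^ 3 * K <= k * r)%N.
  move=> hk; apply: (@leq_trans (k * 1)%N); last by rewrite leq_mul2l r0 orbT.
  rewrite muln1 -(@leq_pmul2l 3) //; apply: leq_trans hk.
  have -> : (3 * (4 * s ^ 3 * K) = 12 * K * s ^ 3)%N by ring.
  by rewrite s4 leq_mul2r large orbT.
have Ks : (K <= s ^ 3)%N.
  apply: (@leq_trans s); first by apply: leq_trans large; rewrite leq_pmull.
  by rewrite -{1}[s]expn1 leq_pexp2l.
have sm : (s ^ 4 <= 3 * m)%N by apply: leq_trans s1 _; move: h2; clear; lia.
have sn : (s ^ 4 <= 3 * n)%N by apply: leq_trans s1 _; move: h1; clear; lia.
apply: le_trans (amean_add dm dn Ks (big m sm) (big n sn)); rewrite lerD2l lerN2.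
rewrite /split_cost -[X in _ <= X]mulrA; apply: ler_wpM2l => //; rewrite natrX natrM.
set N := (m + n)%:R in N16 *.
have N0 : 0 <= N by [].
have sp : 0 < s%:R :> R by lra.
have f1 : N / s%:R ^+ 3 <= 16 * s%:R.
  by rewrite ler_pdivrMr ?exprn_gt0 // -mulrA -exprS.
have f2 : N * (N / (s%:R ^+ 3) ^+ 2) <= 256 * s%:R ^+ 3.
  have -> : N * (N / (s%:R ^+ 3) ^+ 2) = (N / s%:R ^+ 3) ^+ 2.
    by field; exact: lt0r_neq0.
  apply: (@le_trans _ _ ((16 * s%:R) ^+ 2)).
    by rewrite lerXn2r ?nnegrE ?divr_ge0 ?mulr_ge0.
  have -> : (16 * s%:R) ^+ 2 = 256 * s%:R ^+ 2 :> R by ring.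
  by apply: ler_wpM2l => //; rewrite [X in _ <= X]exprS ler_peMl ?exprn_ge0.
have f3 : s%:R <= s%:R ^+ 3 :> R by rewrite ler_eXnr.
have g2 : 2 * (N * r%:R) * K%:R ^+ 2 * (N * r%:R / (s%:R ^+ 3) ^+ 2) <=
   512 * r%:R ^+ 2 * K%:R ^+ 2 * s%:R ^+ 3.
  have -> : 2 * (N * r%:R) * K%:R ^+ 2 * (N * r%:R / (s%:R ^+ 3) ^+ 2) =
     2 * r%:R ^+ 2 * K%:R ^+ 2 * (N * (N / (s%:R ^+ 3) ^+ 2)) by ring.
  have -> : 512 * r%:R ^+ 2 * K%:R ^+ 2 * s%:R ^+ 3 =
     2 * r%:R ^+ 2 * K%:R ^+ 2 * (256 * s%:R ^+ 3) :> R by ring.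
  by rewrite ler_wpM2l // !mulr_ge0 // exprn_ge0.
have g3 : 4 * K%:R ^+ 2 * (N * r%:R / s%:R ^+ 3) <= 64 * K%:R ^+ 2 * r%:R * s%:R ^+ 3.
  have -> : 4 * K%:R ^+ 2 * (N * r%:R / s%:R ^+ 3) = 4 * K%:R ^+ 2 * r%:R * (N / s%:R ^+ 3) by ring.
  have -> : 64 * K%:R ^+ 2 * r%:R * s%:R ^+ 3 = 4 * K%:R ^+ 2 * r%:R * (16 * s%:R ^+ 3) :> R by ring.
  rewrite ler_wpM2l ?mulr_ge0 //; apply: le_trans f1 _; rewrite ler_wpM2l //.
have g4 : 0 <= 384 * K%:R * r%:R * s%:R ^+ 3 :> R by apply: mulr_ge0 => //; rewrite !mulr_ge0.
have dist (x y z t u : R) : (x + y + z + t) * u = x * u + y * u + z * u + t * u by ring.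
by rewrite dist -[X in X <= _]addr0; exact: (lerD (lerD (lerD (lexx _) g2) g3) g4).
Qed.

Lemma amean_limit : exists h : R, forall eta, 0 < eta ->
  exists n0 : nat, forall n, (n0 <= n)%N -> (K %| n * r)%N -> `|amean n / n%:R - h| <= eta.
Proof.
apply: (@near_superadditive_limit R (fun n => K %| n * r)%N amean
  (node_bound M + r%:R * lip M) (2 * r%:R * lip M) split_cost _ _ _ _ _ _ K).
- by move=> m n dm dn; rewrite mulnDl dvdn_add.
- by move=> m n dm; rewrite mulnDl dvdn_addr.
- by move=> n dn; rewrite mulrC; exact: amean_le.
- move=> m n dm dn; apply: le_trans (amean_add_trivial dm dn).
  by rewrite natrM le_eqVlt; apply/orP; left; apply/eqP; ring.
- have K2 : 0 <= K%:R ^+ 2 :> R by rewrite exprn_ge0.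
  apply: mulr_ge0 (lip_ge0 M) _; rewrite !addr_ge0 // !mulr_ge0 // exprn_ge0 //.
- exact: amean_balanced.
- exact: pK_gt0.
- exact: dvdn_mulr.
Qed.

Theorem conv_model_of : exists h : R, conv_in_prob (model_of M) r h.
Proof.
have [h hP] := amean_limit; exists h => eps delta eps0 delta0.
have e2 : 0 < eps ^+ 2 by rewrite exprn_gt0.
have de : 0 < delta * eps ^+ 2 / 4 by rewrite divr_gt0 // mulr_gt0.
(* The cap 1 gives [y ^+ 2 <= eta] for the bias [y], so that [2 * y ^+ 2] uses at most half of
   [delta * eps ^+ 2]; the variance gets the other half. *)
pose eta := Num.min 1 (delta * eps ^+ 2 / 4).
have eta0 : 0 < eta by rewrite lt_min ltr01 de.
have [n0 n0P] := hP _ eta0.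
pose c := 2 * r%:R * (65 * lip M ^+ 2).
have c0 : 0 <= c.
  by apply: mulr_ge0; [exact: mulr_ge0 | apply: mulr_ge0 => //; rewrite exprn_ge0 ?lip_ge0].
pose x := c / (delta * eps ^+ 2 / 2).
have de2 : 0 < delta * eps ^+ 2 / 2 by rewrite divr_gt0 // mulr_gt0.
have x0 : 0 <= x by rewrite divr_ge0 // ltW.
exists (maxn 1 (maxn n0 (Num.bound x))) => n; rewrite !geq_max => /and3P[n1 n2 n3] dn.
have t0 : 'I_n * 'I_r := (Ordinal n1, Ordinal r0).
apply: le_trans (@prob_dev_le R M n r t0 h eps eps0 n1) _; rewrite -/c ler_pdivrMr //.
have nR : 0 < n%:R :> R by rewrite ltr0n.
have cn : c / n%:R <= delta * eps ^+ 2 / 2.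
  rewrite ler_pdivrMr // mulrC -ler_pdivrMr //; apply: le_trans (ltW (archi_boundP x0)) _.
  by rewrite ler_nat.
have := n0P n n2 dn; set y := _ - h => yeta.
have y2 : y ^+ 2 <= eta.
  rewrite -[y ^+ 2]real_normK ?num_real //; apply: (@le_trans _ _ (eta * 1)); last by rewrite mulr1.
  by rewrite expr2 ler_pM // (le_trans yeta) // ge_min lexx.
have : eta <= delta * eps ^+ 2 / 4 by rewrite ge_min lexx orbT.
lra.
Qed.

End Convergence.

(** * The six models *)

Section BadPredicates.
Variables (R : realType) (K : nat).

Lemma perm_spins (A : eqType) (y : 'I_K -> A) (s : {perm 'I_K}) :
  perm_eq [seq y (s k) | k <- enum 'I_K] [seq y k | k <- enum 'I_K].
Proof.
rewrite (map_comp y s); apply: perm_map; apply: uniq_perm; rewrite ?enum_uniq //.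
  by rewrite map_inj_uniq ?enum_uniq //; exact: perm_inj.
move=> k; rewrite mem_enum; apply/mapP; exists ((s^-1)%g k); last by rewrite permKV.
by rewrite mem_enum.
Qed.

Lemma prod_bool (b : 'I_K -> bool) : \prod_k (b k)%:R = [forall k, b k]%:R :> R.
Proof.
case: forallP => [h|h]; first by rewrite big1 // => k _; rewrite h.
have [k bk] : exists k, ~~ b k.
  by apply/existsP; rewrite -negb_forall; apply/negP => /forallP.
by rewrite (bigD1 k) //= (negbTE bk) mul0r.
Qed.

Lemma kpos_all (T : finType) (f : T -> bool) : (0 < K)%N ->
  kpos (fun e : {ffun 'I_K -> T} => [forall k, f (e k)]%:R : R).
Proof.
move=> K0; apply: eq_kpos (kpos_prod K0 (f := fun t => (f t)%:R) _) => [e|t] //.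
exact: prod_bool.
Qed.

(** The indicator of a constant [f] along the edge is the sum over the common value [z] of products
    of indicators. *)
Lemma kpos_constant (T Z : finType) (f : T -> Z) : (0 < K)%N ->
  kpos (fun e : {ffun 'I_K -> T} => [forall k, forall l, f (e k) == f (e l)]%:R : R).
Proof.
move=> K0; pose k0 := Ordinal K0.
have pz z : kpos (fun e : {ffun 'I_K -> T} => [forall k, f (e k) == z]%:R : R).
  exact (kpos_all (fun t => f t == z) K0).
apply: eq_kpos (kpos_sum pz) => e.
rewrite (bigD1 (f (e k0))) //= big1 ?addr0 => [|z zk].
  congr (nat_of_bool _)%:R; apply/forallP/forallP => h k.
    by apply/forallP => l; rewrite (eqP (h k)) eq_sym.
  exact: (forallP (h k) k0).
by case: forallP => // h; have /eqP zE := h k0; rewrite -zE eqxx in zk.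
Qed.

End BadPredicates.

Lemma sum_unit (R : realType) (F : unit -> R) : \sum_a F a = F tt.
Proof. by rewrite (bigD1 tt) //= big1 ?addr0 // => -[]. Qed.

Section EqualityPenalty.
Variables (R : realType) (q : nat) (i0 : 'I_q) (node : 'I_q -> R) (base pen : R).
Hypothesis pen0 : 0 <= pen.

(** Equality of all entries, phrased through membership so that invariance under reordering is
    immediate. *)
Definition eq_bad (a : unit) (s : seq 'I_q) : bool := all (fun x => all (pred1 x) s) s.

Lemma eq_bad_sym (s : {perm 'I_2}) : exists2 phi : unit -> unit, injective phi &
  forall a (y : 'I_2 -> 'I_q),
    eq_bad (phi a) [seq y (s k) | k <- enum 'I_2] = eq_bad a [seq y k | k <- enum 'I_2].
Proof.
exists id => // a y; have h := perm_mem (perm_spins y s).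
by rewrite /eq_bad (eq_all_r h); apply: eq_all => x; exact: eq_all_r.
Qed.

(** All configurations make the edge bad exactly when the vector [sig] of their values agrees at
    both ends. *)
Lemma eq_bad_pos (T : finType) (X : eqType) (F : X -> T -> 'I_q) (y : X) (Y : seq X) :
  kpos (fun e : {ffun 'I_2 -> T} => \sum_a
      (all (fun z => eq_bad a [seq F z (e k) | k <- enum 'I_2]) (y :: Y))%:R : R).
Proof.
pose sig t := map_tuple (fun z => F z t) (in_tuple (y :: Y)).
apply: eq_kpos (kpos_constant sig (isT : (0 < 2)%N)) => e.
rewrite sum_unit; congr (nat_of_bool _)%:R; apply/forallP/allP => [h z zY|h k].
  apply/allP => _ /mapP[k _ ->]; apply/allP => _ /mapP[l _ ->] /=.
  have /eqP/(congr1 val)/= := forallP (h l) k.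
  by move/(@eq_in_map _ _ (F^~ (e l)) (F^~ (e k)) (y :: Y)) => /(_ z zY) ->.
apply/forallP => l; apply/eqP/val_inj/(@eq_in_map _ _ (F^~ (e k)) (F^~ (e l)) (y :: Y)).
move=> z zY; have := h z zY. rewrite /eq_bad => /allP/(_ (F z (e l))).
rewrite map_f ?mem_enum // => /(_ isT).
by move=> /allP/(_ (F z (e k))); rewrite map_f ?mem_enum // => /(_ isT) /eqP.
Qed.

Definition eq_penalty : penalty_model R :=
  @PenaltyModel R 2 q unit i0 tt node base pen eq_bad isT pen0 eq_bad_sym eq_bad_pos.

End EqualityPenalty.

Section OnesPenalty.
Variable R : realType.

Definition ones_bad (a : unit) (s : seq 'I_2) : bool := all (fun i => val i == 1%N) s.

Lemma ones_bad_sym (s : {perm 'I_2}) : exists2 phi : unit -> unit, injective phi &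
  forall a (y : 'I_2 -> 'I_2),
    ones_bad (phi a) [seq y (s k) | k <- enum 'I_2] = ones_bad a [seq y k | k <- enum 'I_2].
Proof. by exists id => // a y; apply: eq_all_r; exact: perm_mem (perm_spins y s). Qed.

Lemma ones_bad_pos (T : finType) (X : eqType) (F : X -> T -> 'I_2) (y : X) (Y : seq X) :
  kpos (fun e : {ffun 'I_2 -> T} => \sum_a
      (all (fun z => ones_bad a [seq F z (e k) | k <- enum 'I_2]) (y :: Y))%:R : R).
Proof.
apply: eq_kpos (kpos_all (fun t => all (fun z => val (F z t) == 1%N) (y :: Y)) (isT : (0 < 2)%N)) => e.
rewrite sum_unit; congr (nat_of_bool _)%:R; apply/forallP/allP => [h z zY|h k].
  by apply/allP => _ /mapP[k _ ->]; have /allP := h k; apply.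
apply/allP => z zY; have := h z zY; rewrite /ones_bad => /allP; apply.
by rewrite map_f ?mem_enum.
Qed.

(* The independence constraint as a unit penalty: deleting one endpoint of each
   violated edge shows that the maximum is unchanged. *)
Definition ones_penalty : penalty_model R :=
  @PenaltyModel R 2 2 unit ord0 tt (fun i => (val i == 1%N)%:R) 0 1 ones_bad isT ler01
    ones_bad_sym ones_bad_pos.

End OnesPenalty.

Section SatPenalty.
Variables (R : realType) (K : nat).
Hypothesis K0 : (0 < K)%N.

Definition sbit (i : 'I_2) : bool := val i == 1%N.

Lemma sbitE (i : 'I_2) (b : bool) : (val i == b :> nat) = (sbit i == b).
Proof. by case: i b => [[|[|//]]] ? []. Qed.

Lemma seq_bitsE (y : 'I_K -> 'I_2) (f : bool -> bool) (a : K.-tuple bool) :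
  ([seq val i | i <- [seq y k | k <- enum 'I_K]] == [seq nat_of_bool (f b) | b <- a])
  = [forall k, sbit (y k) == f (tnth a k)].
Proof.
have E : tval a = [seq tnth a k | k <- enum 'I_K] by rewrite map_tnth_enum.
rewrite E -(map_comp \val y) -(map_comp (fun b => nat_of_bool (f b)) (tnth a)).
apply/eqP/forallP => [/eq_in_map h k|h].
  have kin : k \in enum 'I_K by rewrite mem_enum.
  by rewrite -sbitE; apply/eqP; exact: (h k kin).
by apply/eq_in_map => k _; apply/eqP; rewrite /= sbitE.
Qed.

Definition sat_bad (a : K.-tuple bool) (s : seq 'I_2) : bool :=
  [seq val i | i <- s] == [seq nat_of_bool b | b <- a].

Definition nae_bad (a : K.-tuple bool) (s : seq 'I_2) : bool :=
  ([seq val i | i <- s] == [seq nat_of_bool b | b <- a]) ||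
  ([seq val i | i <- s] == [seq nat_of_bool (~~ b) | b <- a]).

Definition permute (s : {perm 'I_K}) (a : K.-tuple bool) : K.-tuple bool :=
  [tuple tnth a (s k) | k < K].

Lemma permute_inj s : injective (permute s).
Proof.
move=> a b ab; apply: eq_from_tnth => k.
by have := congr1 (fun t => tnth t ((s^-1)%g k)) ab; rewrite !tnth_mktuple permKV.
Qed.

Lemma forall_permute (s : {perm 'I_K}) (y : 'I_K -> 'I_2) (f : bool -> bool) (a : K.-tuple bool) :
  [forall k, sbit (y (s k)) == f (tnth (permute s a) k)] = [forall k, sbit (y k) == f (tnth a k)].
Proof.
apply/forallP/forallP => h k; last by rewrite tnth_mktuple.
by have := h ((s^-1)%g k); rewrite tnth_mktuple permKV.
Qed.

Lemma sat_bad_sym (s : {perm 'I_K}) :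
  exists2 phi : K.-tuple bool -> K.-tuple bool, injective phi &
  forall a (y : 'I_K -> 'I_2),
    sat_bad (phi a) [seq y (s k) | k <- enum 'I_K] = sat_bad a [seq y k | k <- enum 'I_K].
Proof.
exists (permute s); first exact: permute_inj.
move=> a y; rewrite /sat_bad (seq_bitsE (y \o s) id) (seq_bitsE y id).
exact: (forall_permute s y id a).
Qed.

Lemma nae_bad_sym (s : {perm 'I_K}) :
  exists2 phi : K.-tuple bool -> K.-tuple bool, injective phi &
  forall a (y : 'I_K -> 'I_2),
    nae_bad (phi a) [seq y (s k) | k <- enum 'I_K] = nae_bad a [seq y k | k <- enum 'I_K].
Proof.
exists (permute s); first exact: permute_inj.
move=> a y; rewrite /nae_bad (seq_bitsE (y \o s) id) (seq_bitsE y id).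
rewrite (seq_bitsE (y \o s) negb) (seq_bitsE y negb).
by congr (_ || _); [exact: (forall_permute s y id a) | exact: (forall_permute s y negb a)].
Qed.

Lemma tuple_forall (a : K.-tuple bool) (f : 'I_K -> bool) :
  [forall k, f k == tnth a k] = (a == [tuple f k | k < K]).
Proof.
apply/forallP/eqP => [h|-> k]; last by rewrite tnth_mktuple.
by apply: eq_from_tnth => k; rewrite tnth_mktuple (eqP (h k)).
Qed.

(** Exactly one label, the one spelled by [y], is violated by [y]; the others violate it too when
    they agree with [y] at every entry, which is a product condition. *)
Lemma sat_bad_pos (T : finType) (X : eqType) (F : X -> T -> 'I_2) (y : X) (Y : seq X) :
  kpos (fun e : {ffun 'I_K -> T} => \sum_a
      (all (fun z => sat_bad a [seq F z (e k) | k <- enum 'I_K]) (y :: Y))%:R : R).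
Proof.
apply: eq_kpos (kpos_all (fun t => all (fun z => sbit (F z t) == sbit (F y t)) Y) K0) => e.
pose a0 : K.-tuple bool := [tuple sbit (F y (e k)) | k < K].
have E a : all (fun z => sat_bad a [seq F z (e k) | k <- enum 'I_K]) (y :: Y) =
    (a == a0) && [forall k, all (fun z => sbit (F z (e k)) == sbit (F y (e k))) Y].
  rewrite [all _ _]/= /sat_bad (seq_bitsE (fun k => F y (e k)) id) tuple_forall.
  case: eqP => //= ->; apply/allP/forallP => [h k|h z zY].
    apply/allP => z zY; have := h z zY; rewrite (seq_bitsE (fun k => F z (e k)) id).
    by move=> /forallP/(_ k); rewrite tnth_mktuple.
  rewrite (seq_bitsE (fun k => F z (e k)) id); apply/forallP => k; rewrite tnth_mktuple.
  by have /allP := h k; apply.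
under [RHS]eq_bigr => a _ do rewrite E.
rewrite (bigD1 a0) //= eqxx big1 ?addr0 // => a aa.
by rewrite (negbTE aa).
Qed.

(** Two labels are violated by [y], its own values and their complement, whence the factor 2. The
    others violate them too exactly when their exclusive or with [y] is constant along the edge. *)
Lemma nae_bad_pos (T : finType) (X : eqType) (F : X -> T -> 'I_2) (y : X) (Y : seq X) :
  kpos (fun e : {ffun 'I_K -> T} => \sum_a
      (all (fun z => nae_bad a [seq F z (e k) | k <- enum 'I_K]) (y :: Y))%:R : R).
Proof.
pose sig t := map_tuple (fun z => sbit (F z t) (+) sbit (F y t)) (in_tuple Y).
have two0 : 0 <= 2 :> R by [].
apply: eq_kpos (kposZ two0 (kpos_constant sig K0)) => e.
pose a0 : K.-tuple bool := [tuple sbit (F y (e k)) | k < K].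
pose a1 : K.-tuple bool := [tuple ~~ sbit (F y (e k)) | k < K].
have badE z a : nae_bad a [seq F z (e k) | k <- enum 'I_K] =
   [forall k, sbit (F z (e k)) == tnth a k] || [forall k, sbit (F z (e k)) == ~~ tnth a k].
  by rewrite /nae_bad (seq_bitsE (fun k => F z (e k)) id) (seq_bitsE (fun k => F z (e k)) negb).
have a01 : a1 != a0.
  apply/eqP => /(congr1 (fun t => tnth t (Ordinal K0))).
  by rewrite !tnth_mktuple; case: sbit.
have E a : all (fun z => nae_bad a [seq F z (e k) | k <- enum 'I_K]) (y :: Y) =
    ((a == a0) || (a == a1)) && [forall k, forall l, sig (e k) == sig (e l)].
  rewrite [all _ _]/= badE tuple_forall.
  have -> : [forall k, sbit (F y (e k)) == ~~ tnth a k] = (a == a1).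
    by rewrite -tuple_forall; apply: eq_forallb => k; case: (sbit _); case: (tnth a k).
  have [aE|//] := boolP ((a == a0) || (a == a1)).
  have xorE : exists b, forall k, tnth a k = sbit (F y (e k)) (+) b.
    case/orP: aE => /eqP ->; [exists false|exists true] => k; rewrite tnth_mktuple.
      by rewrite addbF.
    by rewrite addbT.
  have [b bE] := xorE; rewrite /=; apply/allP/forallP => [h k|h z zY].
    apply/forallP => l; apply/eqP/val_inj => /=; apply/eq_in_map => z zY.
    have := h z zY; rewrite badE => /orP[/forallP H|/forallP H];
      have := H k; have := H l; rewrite !bE => /eqP -> /eqP ->;
      by case: (sbit _); case: (sbit _); case: (b).
  have zc k : sbit (F z (e k)) (+) sbit (F y (e k)) =
      sbit (F z (e (Ordinal K0))) (+) sbit (F y (e (Ordinal K0))).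
    have /eqP/(congr1 val)/= := forallP (h k) (Ordinal K0).
    by move=> /eq_in_map/(_ z zY).
  have zE k : sbit (F z (e k)) = sbit (F y (e k)) (+) (sbit (F z (e (Ordinal K0))) (+) sbit (F y (e (Ordinal K0)))).
    by rewrite -(zc k) addbC -addbA addbb addbF.
  rewrite badE; apply/orP.
  have [d|d] := eqVneq (sbit (F z (e (Ordinal K0))) (+) sbit (F y (e (Ordinal K0)))) b.
    by left; apply/forallP => k; rewrite zE d bE.
  right; apply/forallP => k; rewrite zE bE.
  by move: d; case: (_ (+) _); case: (b); case: sbit.
under [RHS]eq_bigr => a _ do rewrite E.
rewrite (bigD1 a0) //= (bigD1 a1) //= !eqxx orbT /= big1 ?addr0.
  by rewrite mulr_natl mulr2n.
by move=> a /andP[n0 n1]; rewrite (negbTE n0) (negbTE n1).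
Qed.

Definition sat_penalty : penalty_model R :=
  @PenaltyModel R K 2 (K.-tuple bool) ord0 [tuple false | _ < K] (fun=> 0) 1 1 sat_bad K0 ler01
    sat_bad_sym sat_bad_pos.

Definition nae_penalty : penalty_model R :=
  @PenaltyModel R K 2 (K.-tuple bool) ord0 [tuple false | _ < K] (fun=> 0) 1 1 nae_bad K0 ler01
    nae_bad_sym nae_bad_pos.

End SatPenalty.

(** * Transfer to models with the same maximum *)

Section Transfer.
Variables (R : realType) (K q : nat) (L : finType) (r : nat).
Variables (hn1 hn2 : 'I_q -> \bar R) (he1 he2 : L -> seq 'I_q -> \bar R).
Local Notation M1 := (@Model R K q L hn1 he1).
Local Notation M2 := (@Model R K q L hn2 he2).

Lemma conv_in_prob_HG (h : R) :
  (forall n (w : sample M1 n r), config_ok M1 w.1 -> @HG R M1 n r w = @HG R M2 n r w) ->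
  conv_in_prob M1 r h -> conv_in_prob M2 r h.
Proof.
move=> E cv eps delta e0 d0; have [n0 h0] := cv eps delta e0 d0.
exists n0 => n n0n dn; apply: le_trans (h0 n n0n dn).
rewrite /prob_dev le_eqVlt; apply/orP; left; apply/eqP; congr (_%:R / _).
apply: eq_card => w; rewrite !inE; apply: andb_id2l => ok.
by rewrite (E n w ok).
Qed.

Lemma size_block_spins n (P : {set {set point n r}}) (B : {set point n r}) (x : {ffun 'I_n -> 'I_q}) :
  config_ok M1 P -> B \in P -> size [seq x i | i <- hyperedge B] = K.
Proof.
move=> /andP[_ /forallP/(_ B)/implyP h] /h /eqP BK.
by rewrite !size_map -cardE.
Qed.

Lemma conv_in_prob_ext (h : R) : hn1 =1 hn2 ->
  (forall a s, size s = K -> he1 a s = he2 a s) ->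
  conv_in_prob M1 r h -> conv_in_prob M2 r h.
Proof.
move=> hn he; apply: conv_in_prob_HG => n w ok; apply: eq_bigr => x _.
rewrite /Hx; congr (_ + _)%E; first by apply: eq_bigr => i _; exact: hn.
by apply: eq_bigr => B BP; apply: he; exact: size_block_spins ok BP.
Qed.

End Transfer.

Section IndependentSet.
Variables (R : realType) (n r : nat).
Local Notation M1 := (model_of (ones_penalty R)).
Local Notation M2 := (IS_model R).
Variable w : sample M1 n r.
Hypothesis ok : config_ok M1 w.1.
Local Notation config := {ffun 'I_n -> 'I_2}.

Let bad (x : config) (B : {set point n r}) : bool :=
  all (fun i : 'I_2 => val i == 1%N) [seq x i | i <- hyperedge B].
Let ones (x : config) : nat := \sum_(v < n) (val (x v) == 1%N).
Let viol (x : config) : nat := \sum_(B in w.1) bad x B.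

Let Hx1 x : @Hx R M1 n r w x = ((ones x)%:R - (viol x)%:R)%:E.
Proof.
rewrite /Hx [\sum_(i < n) _]sumEFin [X in (_ + X)%E]sumEFin -EFinD; congr EFin.
rewrite /ones /viol !natr_sum -sumrN; congr (_ + _).
by apply: eq_bigr => B _; rewrite /= mul1r sub0r.
Qed.

Let Hx2_ok x : viol x = 0%N -> @Hx R M2 n r w x = ((ones x)%:R)%:E.
Proof.
move=> /eqP; rewrite /viol sum_nat_eq0 => /forall_inP nb.
rewrite /Hx [X in (_ + X)%E]big1 ?adde0 => [|B BP].
  rewrite /ones natr_sum -sumEFin; apply: eq_bigr => i _ /=.
  by rewrite /ind; case: eqP.
have := nb B BP; rewrite eqb0 /bad /= => nbB; case: eqP => // E.
by case/negP: nbB; rewrite -(all_map val (fun k => k == 1%N)) E.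
Qed.

Let Hx2_le x : (@Hx R M2 n r w x <= @Hx R M1 n r w x)%E.
Proof.
rewrite /Hx; apply: leeD.
  by apply: lee_sum => i _ /=; rewrite /ind; case: eqP.
apply: lee_sum => B BP /=; rewrite mul1r sub0r.
have sz := @size_block_spins R 2 2 unit r _ _ n w.1 B x ok BP.
case: eqP => [_|]; first exact: leNye.
move: sz; case: [seq x i | i <- hyperedge B] => [|a [|b []]] //= _ ne.
rewrite andbT; case: eqP => [aE|_] /=; last by rewrite oppr0.
by case: eqP => [bE|_] /=; [rewrite aE bE in ne | rewrite oppr0].
Qed.

Let repair x : exists y, (@Hx R M1 n r w x <= @Hx R M2 n r w y)%E.
Proof.
have [m xm] := ubnP (ones x); elim: m x xm => // m IH x xm.
have [v0|] := posnP (viol x); first by exists x; rewrite Hx1 Hx2_ok // v0 subr0.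
rewrite lt0n sum_nat_eq0 => /forall_inPn[B BP]; rewrite eqb0 negbK => bB.
have sz := @size_block_spins R 2 2 unit r _ _ n w.1 B x ok BP.
have [v vB] : exists v, v \in hyperedge B.
  by move: sz; case: (hyperedge B) => // v s _; exists v; rewrite mem_head.
(* Lowering the spin of [v] loses one node, removes the violation at [B] and creates none. *)
pose y : config := [ffun u => if u == v then ord0 else x u].
have xv : val (x v) == 1%N by have /allP := bB; apply; exact: map_f.
have yx u : (val (y u) == 1%N) -> (val (x u) == 1%N).
  by rewrite ffunE; case: (u == v).
have oy : ones x = (ones y).+1.
  rewrite /ones (bigD1 v) //= [in RHS](bigD1 v) //= xv ffunE eqxx /=.
  by rewrite add1n add0n; congr S; apply: eq_bigr => u uv; rewrite ffunE (negbTE uv).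
have vy : (viol y < viol x)%N.
  rewrite /viol (bigD1 B) //= [ltnRHS](bigD1 B) //= bB.
  have -> : bad y B = false.
    by apply/negP => /allP/(_ (y v)); rewrite map_f // ffunE eqxx => /(_ isT).
  rewrite add0n add1n ltnS; apply: leq_sum => B' _.
  case: (boolP (bad y B')) => // /allP h.
  suff -> : bad x B' by [].
  by apply/allP => _ /mapP[u uB ->]; apply/yx/h/map_f.
have [|z hz] := IH y; first by rewrite oy in xm; rewrite -ltnS.
exists z; apply: le_trans hz; rewrite !Hx1 lee_fin oy -natr1.
have : (viol y)%:R + 1 <= (viol x)%:R :> R by rewrite natr1 ler_nat.
lra.
Qed.

Lemma HG_ones_penalty : @HG R M1 n r w = @HG R M2 n r w.
Proof.
apply/eqP; rewrite eq_le; apply/andP; split.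
  apply/bigmax_leP; split=> [|x _]; first exact: leNye.
  have [y hy] := repair x; apply: le_trans hy _.
  exact: (le_bigmax -oo%E (fun x => @Hx R M2 n r w x) y).
apply/bigmax_leP; split=> [|x _]; first exact: leNye.
apply: le_trans (Hx2_le x) _.
exact: (le_bigmax -oo%E (fun x => @Hx R M1 n r w x) x).
Qed.

End IndependentSet.

Lemma eq_badE q (x y : 'I_q) : eq_bad tt [:: x; y] = (x == y).
Proof. by rewrite /eq_bad /= !eqxx !andbT /= [y == x]eq_sym andbb. Qed.

Lemma ind_neg (R : realType) (b : bool) : ind R (~~ b) = (1 - 1 * b%:R)%:E.
Proof. by rewrite /ind mul1r; case: b => /=; rewrite ?subrr ?subr0. Qed.

Theorem theorem3 (R : realType) (r : nat) (hr : (0 < r)%N) :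
  (exists h : R, conv_in_prob (IS_model R) r h) /\
  (exists h : R, conv_in_prob (MAXCUT_model R) r h) /\
  (forall beta B : R, 0 < beta -> exists h : R, conv_in_prob (Ising_model beta B) r h) /\
  (forall q : nat, (0 < q)%N -> exists h : R, conv_in_prob (Coloring_model R q) r h) /\
  (forall K : nat, (2 <= K)%N -> exists h : R, conv_in_prob (KSAT_model R K) r h) /\
  (forall K : nat, (2 <= K)%N -> exists h : R, conv_in_prob (NAEKSAT_model R K) r h).
Proof.
have coloring q : (0 < q)%N -> exists h : R, conv_in_prob (Coloring_model R q) r h.
  move=> q0; have [h cv] := conv_model_of (eq_penalty (Ordinal q0) (fun=> 0) 1 (@ler01 R)) hr.
  exists h; apply: conv_in_prob_ext cv => // -[] [|x [|y []]] // _.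
  by rewrite ind_neg -eq_badE.
split.
  have [h cv] := conv_model_of (ones_penalty R) hr; exists h.
  by apply: conv_in_prob_HG cv => n w ok; exact: HG_ones_penalty.
(* MAX-CUT is 2-Coloring. *)
split; first exact: coloring 2 isT.
split.
  (* The Ising edge energy is [beta] minus a penalty [2 * beta] for equal spins. *)
  move=> beta B beta0; have pen0 : 0 <= 2 * beta by rewrite mulr_ge0 // ltW.
  have [h cv] := conv_model_of
    (eq_penalty (ord0 : 'I_2) (fun i => if val i == 1%N then B else - B) beta pen0) hr.
  exists h; apply: conv_in_prob_ext cv => [i|[] [|x [|y []]] // _] /=; first by case: ifP.
  by rewrite eq_badE; case: eqP => _; congr EFin; rewrite /=; lra.
split; first exact: coloring.
split=> K K2; have K0 : (0 < K)%N := ltnW K2.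
  have [h cv] := conv_model_of (sat_penalty R K0) hr; exists h.
  by apply: conv_in_prob_ext cv => // a s _; rewrite /= ind_neg.
have [h cv] := conv_model_of (nae_penalty R K0) hr; exists h.
by apply: conv_in_prob_ext cv => // a s _; rewrite /= -negb_or ind_neg.
Qed.
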